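(* Let $S(v_1,\gamma_1),\dots,S(v_n,\gamma_n)$ be $n\ge2$ spheres in $\mathbb{R}^d$ with centers $v_i\in\mathbb{R}^d$ and radii $\gamma_i\ge0$, and let $\gamma^*$ be the optimal value of the smallest enclosing sphere problem $$\min_{u\in\mathbb{R}^d,\ \gamma\in\mathbb{R}}\ \gamma\quad\text{s.t.}\quad\|u-v_i\|_2\le\gamma-\gamma_i\quad\forall i\in\{1,\dots,n\}.$$ Let $\varepsilon\in(0,1]$. Then the primal-dual meta-algorithm applied to this problem (described in the context) computes a sphere enclosing all the input spheres with radius at most $(1+\varepsilon)\gamma^*$, in $O\left(\frac{nd\log n}{\varepsilon^2}\right)$ time.
   Context: Time is the number of elementary operations on real numbers (arithmetic, comparisons, square roots, exponentials), and the constant in $O(\cdot)$ is absolute. Second-order cone: $\mathcal{Q}^{d+1}=\{(u;u_0)\in\mathbb{R}^{d+1}:\|u\|_2\le u_0\}$. An element $(u;u_0)\in\mathbb{R}^{d+1}$ has spectral decomposition $\lambda_1q_1+\lambda_2q_2$ with $\lambda_{1,2}=\frac1{\sqrt2}(u_0\pm\|u\|_2)$, $q_{1,2}=\frac1{\sqrt2}(\pm v;1)$, where $v=u/\|u\|_2$ if $u\ne0$ and any unit vector otherwise. Its trace is $\sqrt2u_0$ and $\exp(u;u_0)=e^{\lambda_1}q_1+e^{\lambda_2}q_2$. In a product of such cones (denoted $\oplus$), exponentials are taken componentwise and traces are summed. The meta-algorithm for this problem. Let $D=\max_{i\ge2}(\|v_1-v_i\|_2+\gamma_1+\gamma_i)$;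 $\gamma^*\in[D/2,D]$. Feasibility test for a guess $\alpha$ and tolerance $\varepsilon'$: put $R=\sqrt2$, $\rho=3D/\sqrt2$, $r=2(n-1)$, $T=\lceil4R^2\rho^2\ln r/(\varepsilon'^2\alpha^2)\rceil$, $\eta=\sqrt{\ln r/T}$. Start with $p^{(1)}=e/r$, where $e=\oplus_{i=2}^n(0;\sqrt2)$. In iteration $t=1,\dots,T$, with $p^{(t)}=\oplus_{i=2}^n(w_i^{(t)};s_i^{(t)})\in\oplus_{i=2}^n\mathcal{Q}^{d+1}$ of trace one, solve (in closed form) $$\max_{u,\gamma}\Big(\sum_{i=2}^nw_i^{(t)}\Big)^Tu+\frac{\gamma}{\sqrt2}-\sum_{i=2}^nv_i^Tw_i^{(t)}-\sum_{i=2}^n\gamma_is_i^{(t)}\quad\text{s.t. }\gamma\le\alpha,\ \|u-v_1\|_2\le\gamma-\gamma_1 .$$ If it is infeasible or has negative value, conclude $\gamma^*>\alpha$ and terminate. Otherwise let $(u^{(t)},\gamma^{(t)})$ be an optimal solution (with $\gamma^{(t)}=\alpha$), let $\bar u^{(t)}$ be the average of $u^{(1)},\dots,u^{(t)}$, and set $p^{(t+1)}=\frac1C\exp\big(-\frac{\eta t}{\rho}\oplus_{i=2}^n(\bar u^{(t)}-v_i;\alpha-\gamma_i)\big)$, with $C$ normalizing the trace to one. If there is no termination within $T$ iterations, output the sphere with center $\bar u^{(T)}$ and radius $(1+\varepsilon')\alpha$. Search over $\alpha$: start from $[L_0,U_0]=[D/2,D]$. In step $i\ge1$ run the feasibility test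 with $\alpha_i=L_{i-1}+\frac13(U_{i-1}-L_{i-1})$ and $\varepsilon_i=\frac{1}{3\alpha_i}(U_{i-1}-L_{i-1})$. If it concludes $\gamma^*>\alpha_i$, set $[L_i,U_i]=[\alpha_i,U_{i-1}]$; otherwise set $[L_i,U_i]=[L_{i-1},(1+\varepsilon_i)\alpha_i]$ and keep the sphere found. Continue until $U_i-L_i$ is at most the desired additive error $\varepsilon\gamma^*$. (Initially, the sphere centered at $v_1$ with radius $D$ is an enclosing sphere.) *)

(* Defs.v *)
From mathcomp Require Import all_boot all_order all_algebra.
From mathcomp Require Import all_classical all_reals all_analysis.
From mathcomp Require Import ring lra.

Set Implicit Arguments.
Unset Strict Implicit.
Unset Printing Implicit Defensive.

Import Order.TTheory GRing.Theory Num.Theory.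

Local Open Scope classical_set_scope.
Local Open Scope ring_scope.

(* The library norm on row vectors is the sup norm, hence this definition. *)
Definition l2norm (R : realType) (d : nat) (u : 'rV[R]_d) : R :=
  Num.sqrt (\sum_j u 0 j ^+ 2).

Definition encloses (R : realType) (d k : nat) (v : 'I_k -> 'rV[R]_d)
    (gam : 'I_k -> R) (u : 'rV[R]_d) (g : R) : Prop :=
  forall i, l2norm (u - v i) <= g - gam i.

Definition ses_opt (R : realType) (d k : nat) (v : 'I_k -> 'rV[R]_d)
    (gam : 'I_k -> R) : R :=
  inf [set g | exists u, encloses v gam u g].

(* Computations on reals, with the number of elementary operations performed.
   Only real operations are charged: [ret] is free and is applied below only to
   literals, inputs and previously computed values (the notation is [$ x]), and
   integer loop indices and array accesses are free.  The loops [sumT], [maxT],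
   [rowT] and [tabT] charge everything their bodies do, plus one addition or
   comparison per element in the case of [sumT] and [maxT].  The logarithm, used
   only for ln r, counts as one operation, like the exponential. *)
Record timed (A : Type) := Timed { ops : nat; result : A }.

Section Primitives.
Context {R : realType}.

Definition ret (A : Type) (a : A) : timed A := Timed 0 a.

Definition bind (A B : Type) (x : timed A) (f : A -> timed B) : timed B :=
  Timed (ops x + ops (f (result x)))%N (result (f (result x))).

Definition op1 (A B : Type) (f : A -> B) (x : timed A) : timed B :=
  Timed (ops x).+1 (f (result x)).

Definition op2 (A B C : Type) (f : A -> B -> C) (x : timed A) (y : timed B) :
    timed C :=
  Timed (ops x + ops y).+1 (f (result x) (result y)).

Definition oppT : timed R -> timed R := op1 (fun a => - a).
Definition addT : timed R -> timed R -> timed R := op2 (fun a b => a + b).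
Definition subT : timed R -> timed R -> timed R := op2 (fun a b => a - b).
Definition mulT : timed R -> timed R -> timed R := op2 (fun a b => a * b).
Definition divT : timed R -> timed R -> timed R := op2 (fun a b => a / b).
Definition sqrT : timed R -> timed R := op1 (fun a => a * a).
Definition sqrtT : timed R -> timed R := op1 (@Num.sqrt R).
Definition expT : timed R -> timed R := op1 (@expR R).
Definition lnT : timed R -> timed R := op1 (@ln R).
Definition leT : timed R -> timed R -> timed bool := op2 (fun a b => a <= b).
Definition ltT : timed R -> timed R -> timed bool := op2 (fun a b => a < b).
Definition eqT : timed R -> timed R -> timed bool := op2 (fun a b => a == b).

(* The ceiling of a nonnegative real is found by incrementing a counter from 0
   until it is at least that real: one comparison and one addition per unit.
   The counter is a real, so the cast [T%:R] of the result is free. *)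
Definition ceilT (x : timed R) : timed nat :=
  let T := `|Num.ceil (result x)|%N in Timed (ops x + T.*2.+1)%N T.

Definition sumT (k : nat) (f : 'I_k -> timed R) : timed R :=
  Timed (\sum_i (ops (f i)).+1)%N (\sum_i result (f i)).

(* Only used for nonnegative quantities. *)
Definition maxT (k : nat) (f : 'I_k -> timed R) : timed R :=
  Timed (\sum_i (ops (f i)).+1)%N (\big[Num.max/0]_i result (f i)).

Definition rowT (k : nat) (f : 'I_k -> timed R) : timed 'rV[R]_k :=
  Timed (\sum_j ops (f j))%N (\row_j result (f j)).

Definition tabT (A : Type) (k : nat) (f : 'I_k -> timed A) :
    timed ('I_k -> A) :=
  Timed (\sum_i ops (f i))%N (fun i => result (f i)).

End Primitives.

Declare Scope timed_scope.
Delimit Scope timed_scope with T.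
Notation "$ x" := (ret x) (at level 1, x at level 9, format "$ x") : timed_scope.
Notation "- x" := (oppT x) : timed_scope.
Notation "x + y" := (addT x y) : timed_scope.
Notation "x - y" := (subT x y) : timed_scope.
Notation "x * y" := (mulT x y) : timed_scope.
Notation "x / y" := (divT x y) : timed_scope.
Notation "'let!' x ':=' a 'in' b" := (bind a (fun x => b))
  (at level 200, x name, a at level 200, b at level 200,
   format "'let!'  x  ':='  a  'in' '//' b") : timed_scope.

Section Algorithm.
Context {R : realType} {d : nat}.

Section VectorOps.
Local Open Scope timed_scope.

Definition normT (u : 'rV[R]_d) : timed R :=
  sqrtT (sumT (fun j => sqrT ($ (u 0%R j)))).

Definition dotT (u w : 'rV[R]_d) : timed R :=
  sumT (fun j => $ (u 0%R j) * $ (w 0%R j)).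

Definition addV (u w : 'rV[R]_d) : timed 'rV[R]_d :=
  rowT (fun j => $ (u 0%R j) + $ (w 0%R j)).

Definition subV (u w : 'rV[R]_d) : timed 'rV[R]_d :=
  rowT (fun j => $ (u 0%R j) - $ (w 0%R j)).

Definition divV (u : 'rV[R]_d) (a : R) : timed 'rV[R]_d :=
  rowT (fun j => $ (u 0%R j) / $ a).

End VectorOps.

(* An element (u; u_0) of R^(d+1). *)
Notation soc := ('rV[R]_d * R)%type.

Section Cones.
Local Open Scope timed_scope.

(* [dir0] is the unit vector used in the spectral decomposition when u = 0. *)
Definition soc_expT (dir0 : 'rV[R]_d) (x : soc) : timed soc :=
  let! nu := normT x.1 in
  let! null := eqT ($ nu) ($ 0) in
  let! dir := (if null then $ dir0 else divV x.1 nu) in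
  let! c := $ 1 / sqrtT ($ 2) in
  let! e1 := expT ($ c * ($ (x.2) + $ nu)) in
  let! e2 := expT ($ c * ($ (x.2) - $ nu)) in
  let! w := rowT (fun j => $ e1 * ($ c * $ (dir 0%R j))
                         + $ e2 * ($ c * - $ (dir 0%R j))) in
  let! s := $ e1 * $ c + $ e2 * $ c in
  $ (w, s).

Definition traceT (k : nat) (x : 'I_k -> soc) : timed R :=
  sumT (fun i => sqrtT ($ 2) * $ ((x i).2)).

Definition sum_divT (k : nat) (x : 'I_k -> soc) (a : R) :
    timed ('I_k -> soc) :=
  tabT (fun i => let! w := divV (x i).1 a in
                 let! s := $ ((x i).2) / $ a in
                 $ (w, s)).

End Cones.

(* There are n = m.+1 spheres.  The distinguished first one has index [ord0],
   and i : 'I_m stands for the i-th of the m = n - 1 remaining ones. *)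
Context {m : nat}.
Variables (v : 'I_m.+1 -> 'rV[R]_d) (gam : 'I_m.+1 -> R).
Let v1 := v ord0.
Let gam1 := gam ord0.
Let vs (i : 'I_m) := v (lift ord0 i).
Let gams (i : 'I_m) := gam (lift ord0 i).

Section Program.
Local Open Scope timed_scope.

Definition diamT : timed R :=
  maxT (fun i => let! x := subV v1 (vs i) in
                 normT x + $ gam1 + $ (gams i)).

(* Closed-form solution of the problem of one iteration: gamma = alpha and
   u = v_1 + (alpha - gamma_1) z, where z is the direction of W = sum_i w_i if
   W <> 0 and any point [tie] of the unit ball otherwise.  [None] means that the
   problem is infeasible or has negative value.  See [solveT_SomeP] and
   [solveT_NoneP]. *)
Definition solveT (alpha : R) (p : 'I_m -> soc) (tie : 'rV[R]_d) :
    timed (option 'rV[R]_d) :=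
  let! feas := leT ($ gam1) ($ alpha) in
  if ~~ feas then $ None else
  let! W := rowT (fun j => sumT (fun i => $ ((p i).1 0%R j))) in
  let! nW := normT W in
  let! null := eqT ($ nW) ($ 0) in
  let! z := (if null then $ tie else divV W nW) in
  let! u := rowT (fun j => $ (v1 0%R j) + ($ alpha - $ gam1) * $ (z 0%R j)) in
  let! val := dotT W u + $ alpha / sqrtT ($ 2)
              - sumT (fun i => dotT (vs i) (p i).1)
              - sumT (fun i => $ (gams i) * $ ((p i).2)) in
  let! neg := ltT ($ val) ($ 0) in
  if neg then $ None else $ (Some u).

Variable dir0 : 'rV[R]_d.

(* p^(t+1), from the iteration number t and the average center. *)
Definition nextT (alpha eta rho t : R) (ubar : 'rV[R]_d) :
    timed ('I_m -> soc) :=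
  let! c := - ($ eta * $ t / $ rho) in
  let! x := tabT (fun i =>
    let! w := rowT (fun j => $ c * ($ (ubar 0%R j) - $ (vs i 0%R j))) in
    let! s := $ c * ($ alpha - $ (gams i)) in
    soc_expT dir0 (w, s)) in
  let! C := traceT x in
  sum_divT x C.

(* [k] iterations remain, the next one being number [t], which is also kept as
   the real number [tr]; [S] and [ubar] are the sum and the average of the
   centers found so far. *)
Fixpoint iterT (alpha eps eta rho : R) (tie : nat -> 'rV[R]_d)
    (k t : nat) (tr : R) (p : 'I_m -> soc) (S ubar : 'rV[R]_d) :
    timed (option ('rV[R]_d * R)) :=
  if k is k'.+1 then
    let! o := solveT alpha p (tie t) in
    if o is Some u then
      let! S' := addV S u in
      let! ubar' := divV S' tr in
      let! p' := nextT alpha eta rho tr ubar' in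
      let! tr' := $ tr + $ 1 in
      iterT alpha eps eta rho tie k' t.+1 tr' p' S' ubar'
    else $ None
  else
    let! rad := ($ 1 + $ eps) * $ alpha in
    $ (Some (ubar, rad)).

(* Feasibility test; [None] is the conclusion gamma* > alpha. *)
Definition testT (D alpha eps : R) (tie : nat -> 'rV[R]_d) :
    timed (option ('rV[R]_d * R)) :=
  let! r := $ 2 * sumT (fun _ : 'I_m => $ 1) in
  let! Rb := sqrtT ($ 2) in
  let! rho := $ 3 * $ D / sqrtT ($ 2) in
  let! lnr := lnT ($ r) in
  let! T := ceilT ($ 4 * sqrT ($ Rb) * sqrT ($ rho) * $ lnr
                   / (sqrT ($ eps) * sqrT ($ alpha))) in
  let! eta := sqrtT ($ lnr / $ (T%:R)) in
  let! s0 := sqrtT ($ 2) in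
  let! p1 := sum_divT (fun _ => (0%R, s0)) r in
  iterT alpha eps eta rho tie T 1 1%R p1 0%R 0%R.

(* The search; [i] numbers its steps, [thr] is the additive error sought and
   [best] is the last sphere found.  Running out of fuel gives [None]. *)
Fixpoint searchT (D thr : R) (tie : nat -> nat -> 'rV[R]_d)
    (fuel i : nat) (L U : R) (best : 'rV[R]_d * R) :
    timed (option ('rV[R]_d * R)) :=
  if fuel is fuel'.+1 then
    let! stop := leT ($ U - $ L) ($ thr) in
    if stop then $ (Some best) else
    let! alpha := $ L + $ 1 / $ 3 * ($ U - $ L) in
    let! eps := $ 1 / ($ 3 * $ alpha) * ($ U - $ L) in
    let! o := testT D alpha eps (tie i) in
    if o is Some sph then
      let! U' := ($ 1 + $ eps) * $ alpha in
      searchT D thr tie fuel' i.+1 L U' sph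
    else searchT D thr tie fuel' i.+1 alpha U best
  else $ None.

(* The additive error sought is eps * gamma*, and gamma* is not an input.
   With [opt = Some g] the value g is used for gamma*; with [opt = None] the
   program uses instead the lower bound L_0 = D / 2 that it has computed.
   [tie i t] resolves the choice of an optimal solution, when there are several,
   in iteration t of the test of step i. *)
Definition metaT (eps : R) (opt : option R) (tie : nat -> nat -> 'rV[R]_d)
    (fuel : nat) : timed (option ('rV[R]_d * R)) :=
  let! D := diamT in
  let! L0 := $ D / $ 2 in
  let! thr := $ eps * $ (odflt L0 opt) in
  searchT D thr tie fuel 1 L0 D (v1, D).

End Program.

(* The problem solved in one iteration.  The lemmas below say that [solveT]
   solves it and that every optimal solution is obtained for some [tie]. *)

Definition sub_feasible (alpha : R) (u : 'rV[R]_d) (g : R) : Prop :=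
  g <= alpha /\ l2norm (u - v1) <= g - gam1.

Definition sub_value (p : 'I_m -> soc) (u : 'rV[R]_d) (g : R) : R :=
  \sum_j (\sum_i (p i).1) 0 j * u 0 j + g / Num.sqrt 2
  - \sum_i \sum_j vs i 0 j * (p i).1 0 j - \sum_i gams i * (p i).2.

Definition sub_optimal (alpha : R) (p : 'I_m -> soc) (u : 'rV[R]_d) (g : R) :
    Prop :=
  sub_feasible alpha u g /\
  forall u' g', sub_feasible alpha u' g' -> sub_value p u' g' <= sub_value p u g.

Section ClosedForm.
Implicit Types (u a b : 'rV[R]_d) (p : 'I_m -> soc).

Let dot a b : R := \sum_j a 0 j * b 0 j.

Let l2_ge0 a : 0 <= l2norm a. Proof. exact: sqrtr_ge0. Qed.

Let l2_sq a : l2norm a ^+ 2 = dot a a.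
Proof.
rewrite sqr_sqrtr; last by apply: sumr_ge0 => j _; exact: sqr_ge0.
by apply: eq_bigr => j _; rewrite expr2.
Qed.

Let l2_eq0 a : l2norm a = 0 -> a = 0.
Proof.
move=> a0; have /eqP := l2_sq a; rewrite a0 expr0n /= eq_sym psumr_eq0; last first.
  by move=> j _; rewrite -expr2 sqr_ge0.
move=> /allP h; apply/rowP => j; rewrite mxE.
by have := h j (mem_index_enum _); rewrite /= mulf_eq0 orbb => /eqP.
Qed.

Let l2_0 : l2norm (0 : 'rV[R]_d) = 0.
Proof. by rewrite /l2norm big1 ?sqrtr0// => j _; rewrite mxE expr0n. Qed.

Let l2_Z (k : R) a : 0 <= k -> l2norm (k *: a) = k * l2norm a.
Proof.
move=> k0; rewrite /l2norm; under eq_bigr => j _ do rewrite mxE exprMn.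
by rewrite -mulr_sumr sqrtrM ?sqr_ge0// sqrtr_sqr ger0_norm.
Qed.

Let dotDr a b c : dot a (b + c) = dot a b + dot a c.
Proof.
by rewrite /dot -big_split; apply: eq_bigr => j _; rewrite mxE mulrDr.
Qed.

Let dotZr k a b : dot a (k *: b) = k * dot a b.
Proof.
by rewrite /dot mulr_sumr; apply: eq_bigr => j _; rewrite mxE mulrCA.
Qed.

Let dotC a b : dot a b = dot b a.
Proof. by apply: eq_bigr => j _; rewrite mulrC. Qed.

Let dot0 b : dot 0 b = 0.
Proof. by rewrite /dot big1 // => j _; rewrite mxE mul0r. Qed.

Let gap a b : l2norm (l2norm b *: a + (- l2norm a) *: b) ^+ 2 =
  2 * (l2norm a * l2norm b) * (l2norm a * l2norm b - dot a b).
Proof.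
rewrite l2_sq !dotDr !dotZr ![dot (_ + _) _]dotC !dotDr !dotZr.
by rewrite (dotC b a) -!l2_sq; ring.
Qed.

Let cauchy a b : dot a b <= l2norm a * l2norm b.
Proof.
have [a0|a0] := eqVneq (l2norm a) 0.
  by rewrite a0 mul0r (l2_eq0 a0) dot0.
have [b0|b0] := eqVneq (l2norm b) 0.
  by rewrite b0 mulr0 (l2_eq0 b0) dotC dot0.
have := sqr_ge0 (l2norm (l2norm b *: a + (- l2norm a) *: b)).
rewrite gap pmulr_rge0 ?subr_ge0//.
by rewrite mulr_gt0 ?ltr0n// mulr_gt0// lt_neqAle eq_sym ?a0 ?b0 l2_ge0.
Qed.

Let cauchy_eq a b : dot a b = l2norm a * l2norm b ->
  l2norm b *: a = l2norm a *: b.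
Proof.
move=> e; apply/eqP; rewrite -subr_eq0 -scaleNr; apply/eqP/l2_eq0/eqP.
by rewrite -sqrf_eq0 gap e subrr mulr0.
Qed.

Let W p : 'rV[R]_d := \sum_i (p i).1.

(* The part of the objective that depends neither on u nor on gamma. *)
Let cst p : R := \sum_i \sum_j vs i 0 j * (p i).1 0 j + \sum_i gams i * (p i).2.

Let valE p u g : sub_value p u g =
  dot (W p) v1 + dot (W p) (u - v1) + g / Num.sqrt 2 - cst p.
Proof.
have -> : dot (W p) v1 + dot (W p) (u - v1) = dot (W p) u.
  by rewrite -dotDr addrC subrK.
by rewrite /sub_value /cst /dot /W; ring.
Qed.

Let zdir p tie : 'rV[R]_d :=
  if l2norm (W p) == 0 then tie else (l2norm (W p))^-1 *: W p.

Let solveTE alpha p tie : result (solveT alpha p tie) =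
  if gam1 <= alpha then
    let u := v1 + (alpha - gam1) *: zdir p tie in
    if sub_value p u alpha < 0 then None else Some u
  else None.
Proof.
have nE a : Num.sqrt (\sum_j (a 0 j * a 0 j)) = l2norm a.
  by congr Num.sqrt; apply: eq_bigr => j _; rewrite expr2.
rewrite /solveT [LHS]/=; case: ifPn => [|/negPn] h; first by rewrite (negPf h).
rewrite h [LHS]/=.
have -> : \row_j \sum_i (p i).1 0 j = W p by apply/rowP => j; rewrite mxE summxE.
rewrite nE.
have -> : result (if l2norm (W p) == 0 then ret tie else divV (W p) (l2norm (W p)))
    = zdir p tie.
  by rewrite /zdir; case: ifP => // _; apply/rowP => j; rewrite !mxE mulrC.
have -> : \row_j (v1 0 j + (alpha - gam1) * zdir p tie 0 j) =
   v1 + (alpha - gam1) *: zdir p tie by apply/rowP => j; rewrite !mxE.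
rewrite /sub_value /= -/(W p); by case: ifP.
Qed.

Let zdir_le1 p tie : l2norm tie <= 1 -> l2norm (zdir p tie) <= 1.
Proof.
rewrite /zdir; case: ifPn => // W0 _.
by rewrite l2_Z ?invr_ge0 ?l2_ge0// mulVf.
Qed.

Let dot_zdir p tie : dot (W p) (zdir p tie) = l2norm (W p).
Proof.
rewrite /zdir; case: ifPn => [/eqP W0|W0]; first by rewrite W0 (l2_eq0 W0) dot0.
by rewrite dotZr -l2_sq expr2 mulKf.
Qed.

Let val_le alpha p u g : sub_feasible alpha u g -> sub_value p u g <=
  dot (W p) v1 + l2norm (W p) * (g - gam1) + g / Num.sqrt 2 - cst p.
Proof.
case=> _ ug; rewrite valE lerD2r lerD2r lerD2l.
by apply: (le_trans (cauchy _ _)); rewrite ler_wpM2l ?l2_ge0.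
Qed.

Let addAK a b : a + b - a = b. Proof. by rewrite addrC addKr. Qed.

Let val_sol alpha p tie :
  sub_value p (v1 + (alpha - gam1) *: zdir p tie) alpha =
  dot (W p) v1 + l2norm (W p) * (alpha - gam1) + alpha / Num.sqrt 2 - cst p.
Proof. by rewrite valE addAK dotZr dot_zdir [_ * (_ - _)]mulrC. Qed.

Let mono (alpha g : R) p : g <= alpha ->
  dot (W p) v1 + l2norm (W p) * (g - gam1) + g / Num.sqrt 2 - cst p <=
  dot (W p) v1 + l2norm (W p) * (alpha - gam1) + alpha / Num.sqrt 2 - cst p.
Proof.
move=> ga; rewrite lerD2r lerD ?lerD2l ?ler_wpM2l ?lerD2r ?l2_ge0//.
by rewrite ler_wpM2r ?invr_ge0 ?sqrtr_ge0.
Qed.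

Let sol_optimal alpha p tie : l2norm tie <= 1 -> gam1 <= alpha ->
  sub_optimal alpha p (v1 + (alpha - gam1) *: zdir p tie) alpha.
Proof.
move=> t1 ag; split.
  split=> //; rewrite addAK l2_Z ?subr_ge0//.
  by rewrite ler_piMr ?subr_ge0 ?zdir_le1.
move=> u' g' f'; rewrite val_sol; apply: (le_trans (val_le p f')).
by apply: mono; case: f'.
Qed.

Let feasible_gam1 alpha u g : sub_feasible alpha u g -> gam1 <= alpha.
Proof.
by case=> ga /(le_trans (l2_ge0 _)); rewrite subr_ge0 => /le_trans; apply.
Qed.

Lemma sub_optimal_gamma alpha p u g : sub_optimal alpha p u g -> g = alpha.
Proof.
case=> f o; have ag := feasible_gam1 f.
have t1 : l2norm (0 : 'rV[R]_d) <= 1 by rewrite l2_0.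
have := o _ _ (sol_optimal p t1 ag).1; rewrite val_sol => h.
have {}h := le_trans h (val_le p f).
apply/eqP; rewrite eq_le f.1 /= leNgt; apply/negP => ga.
have : l2norm (W p) * (g - gam1) <= l2norm (W p) * (alpha - gam1).
  by rewrite ler_wpM2l ?l2_ge0 ?lerD2r ?(ltW ga).
have : g / Num.sqrt 2 < alpha / Num.sqrt 2.
  by rewrite ltr_pM2r ?invr_gt0 ?sqrtr_gt0.
by move: h; lra.
Qed.

Lemma solveT_SomeP alpha p u :
  (exists2 tie, l2norm tie <= 1 & result (solveT alpha p tie) = Some u) <->
  sub_optimal alpha p u alpha /\ 0 <= sub_value p u alpha.
Proof.
split.
  move=> [tie t1]; rewrite solveTE; case: ifP => //= ag; case: ltP => // v0 [<-].
  by split => //; exact: sol_optimal.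
move=> [[f o] v0]; have ag := feasible_gam1 f.
have t01 : l2norm (0 : 'rV[R]_d) <= 1 by rewrite l2_0.
suff [tie t1 e] : exists2 tie, l2norm tie <= 1 &
    v1 + (alpha - gam1) *: zdir p tie = u.
  by exists tie => //; rewrite solveTE ag /= e ltNge v0.
have [ag0|ag0] := eqVneq (alpha - gam1) 0.
  exists 0 => //; rewrite ag0 scale0r addr0.
  have /le_anti : l2norm (u - v1) <= 0 <= l2norm (u - v1).
    by rewrite l2_ge0 -ag0 f.2.
  by move=> /l2_eq0 /eqP; rewrite subr_eq0 => /eqP.
have agp : 0 < alpha - gam1 by rewrite lt_neqAle eq_sym ag0 subr_ge0.
have [W0|W0] := eqVneq (l2norm (W p)) 0.
  exists ((alpha - gam1)^-1 *: (u - v1)).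
    by rewrite l2_Z ?invr_ge0 ?(ltW agp)// mulrC ler_pdivrMr// mul1r f.2.
  by rewrite /zdir W0 eqxx scalerA divff// scale1r addrC subrK.
exists 0 => //.
have Wp : 0 < l2norm (W p) by rewrite lt_neqAle eq_sym W0 l2_ge0.
have := o _ _ (sol_optimal p t01 ag).1; rewrite val_sol valE => h.
have h1 : l2norm (W p) * (alpha - gam1) <= dot (W p) (u - v1) by move: h; lra.
have h2 := cauchy (W p) (u - v1).
have h3 : l2norm (W p) * l2norm (u - v1) <= l2norm (W p) * (alpha - gam1).
  by rewrite ler_pM2l ?f.2.
have en : l2norm (u - v1) = alpha - gam1.
  by apply: (mulfI W0); apply: le_anti; rewrite h3 (le_trans h1 h2).
have /cauchy_eq : dot (W p) (u - v1) = l2norm (W p) * l2norm (u - v1).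
  by apply: le_anti; rewrite h2 en h1.
rewrite en /zdir (negPf W0) scalerA mulrC -scalerA => ->.
by rewrite scalerA mulVf// scale1r addrC subrK.
Qed.

Lemma solveT_NoneP alpha p tie : l2norm tie <= 1 ->
  result (solveT alpha p tie) = None <->
  (forall u g, sub_feasible alpha u g -> sub_value p u g < 0).
Proof.
move=> t1; rewrite solveTE; case: ifPn => [ag|/negP ag]; last first.
  by split => // _ u g /feasible_gam1.
have [fo oo] := sol_optimal p t1 ag.
rewrite /=; case: ltP => v0; split => //.
  by move=> _ u g /oo /le_lt_trans; apply.
by move=> /(_ _ _ fo); rewrite ltNge v0.
Qed.

End ClosedForm.

End Algorithm.

(* Main.v *)
(* The test is matrix multiplicative weights on a product of second-order cones.
   With the potential Phi, the trace of the exponential of the accumulated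
   losses scaled by - eta / rho, p^(t) is the exponential divided by Phi, so the
   Golden-Thompson inequality gives
     Phi_(t+1) <= Phi_t * (1 + eta^2 - (eta / rho) * value_t),
   where value_t is the value of the problem of iteration t.  If all values are
   nonnegative, then Phi_(T+1) <= r * (1 + eta^2)^T <= r^2, as eta^2 T = ln r,
   and each exponentiated eigenvalue is at most r^2; by the choice of T this bounds
   the violation of each constraint by eps' * alpha.  If the test fails, no
   sphere of radius alpha encloses, as such a sphere would have nonnegative
   value.  For the second-order cone, Golden-Thompson amounts to the convexity
   of cosh (sqrt s).
   In the search U - L shrinks by the factor 2/3 in each step and the step costs
   O(n d D^2 ln r / (U - L)^2), so the last step dominates the total cost. *)
Require Import Defs.
From mathcomp Require Import all_boot all_order all_algebra.
From mathcomp Require Import all_classical all_reals all_analysis.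
From mathcomp Require Import ring lra zify.

Set Implicit Arguments.
Unset Strict Implicit.
Unset Printing Implicit Defensive.

Import Order.TTheory GRing.Theory Num.Theory.

Local Open Scope ring_scope.

(** * Scalar inequalities for powers and exponentials *)

Section Scalar.
Import numFieldNormedType.Exports.
Local Open Scope classical_set_scope.
Local Open Scope ring_scope.

Context {R : realType}.
Implicit Types (a b x y t l : R) (n : nat).

(** Induction on [n]: the defect of a step is [l * (1 - l)] times [(x - y) * (x ^+ n - y ^+ n)],
    whose factors have the same sign. *)
Lemma expr_convex l x y n : 0 <= l <= 1 -> 0 <= x -> 0 <= y ->
  (l * x + (1 - l) * y) ^+ n <= l * x ^+ n + (1 - l) * y ^+ n.
Proof.
move=> /andP[l0 l1] x0 y0; have l1' : 0 <= 1 - l by rewrite subr_ge0.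
elim: n => [|n IH]; first by rewrite !expr0; lra.
rewrite exprS; apply: (@le_trans _ _
  ((l * x + (1 - l) * y) * (l * x ^+ n + (1 - l) * y ^+ n))).
  by rewrite ler_wpM2l// addr_ge0// mulr_ge0.
have h : 0 <= (x - y) * (x ^+ n - y ^+ n).
  have [xy|/ltW xy] := leP x y.
    by apply: mulr_le0; rewrite subr_le0 ?lerXn2r.
  by apply: mulr_ge0; rewrite subr_ge0 ?lerXn2r.
rewrite -subr_ge0 (_ : _ - _ = l * (1 - l) * ((x - y) * (x ^+ n - y ^+ n))).
  by rewrite mulr_ge0// mulr_ge0.
by rewrite !exprS; ring.
Qed.

(** Odd terms cancel, and even terms are powers of the square, to which [expr_convex] applies. *)
Lemma exp_coeff_even_convex l x a b n : 0 <= l <= 1 ->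
  x ^+ 2 = l * a ^+ 2 + (1 - l) * b ^+ 2 ->
  exp_coeff x n + exp_coeff (- x) n <=
  l * (exp_coeff a n + exp_coeff (- a) n) +
  (1 - l) * (exp_coeff b n + exp_coeff (- b) n).
Proof.
move=> l01 xE; rewrite /exp_coeff /= -!mulrDl !mulrA -mulrDl.
rewrite ler_wpM2r ?invr_ge0 ?ler0n//.
rewrite (exprNn x) (exprNn a) (exprNn b) -signr_odd.
case: (boolP (odd n)) => [_|/even_halfK nE]; first by rewrite expr1; lra.
rewrite expr0 -nE -mul2n !exprM !mul1r.
have := expr_convex n./2 l01 (sqr_ge0 a) (sqr_ge0 b); rewrite -xE.
lra.
Qed.

(* [cosh] is a power series in [x ^+ 2] with nonnegative coefficients, hence
   [cosh \o sqrt] is convex. *)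
Lemma cosh_sqrt_convex l x a b : 0 <= l <= 1 ->
  x ^+ 2 = l * a ^+ 2 + (1 - l) * b ^+ 2 ->
  expR x + expR (- x) <=
  l * (expR a + expR (- a)) + (1 - l) * (expR b + expR (- b)).
Proof.
move=> l01 xE.
have cvgE (y : R) : series (exp_coeff y) @ \oo --> expR y.
  exact: is_cvg_series_exp_coeff.
have cvgS (y : R) : series (exp_coeff y) n + series (exp_coeff (- y)) n
    @[n --> \oo] --> expR y + expR (- y) by exact: cvgD.
have cvgR : l * (series (exp_coeff a) n + series (exp_coeff (- a)) n) +
    (1 - l) * (series (exp_coeff b) n + series (exp_coeff (- b)) n)
    @[n --> \oo] --> l * (expR a + expR (- a)) + (1 - l) * (expR b + expR (- b)).
  by apply: cvgD; apply: cvgMr; exact: cvgS.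
apply: (ler_cvg_to (cvgS x) cvgR).
near=> N; rewrite /series /= -!big_split /= !mulr_sumr -big_split /=.
by apply: ler_sum => k _; exact: exp_coeff_even_convex.
Unshelve. all: by end_near. Qed.

(** Squaring [expR (t / 2) * (1 - t / 2) <= 1] reduces the claim to
    [1 <= (1 + t + t ^+ 2) * (1 - t / 2) ^+ 2], a polynomial inequality valid for [t <= 3^-1]. *)
Lemma expR_le_quad t : t <= 3^-1 -> expR t <= 1 + t + t ^+ 2.
Proof.
move=> t3; have h : 0 < 1 - t / 2 by lra.
have e1 : expR (t / 2) * (1 - t / 2) <= 1.
  rewrite -[leRHS](expRxMexpNx_1 (t / 2)) ler_wpM2l ?expR_ge0//.
  exact: expR_ge1Dx.
have e2 : expR t * (1 - t / 2) ^+ 2 <= 1.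
  rewrite [X in expR X](splitr t) expRD.
  rewrite (_ : _ * _ = (expR (t / 2) * (1 - t / 2)) ^+ 2); last by ring.
  rewrite expr_le1// mulr_ge0 ?expR_ge0//; exact: ltW.
rewrite -(ler_pM2r (exprn_gt0 2 h)); apply: (le_trans e2).
have : 0 <= t ^+ 2 * (1 - 3 * t + t ^+ 2).
  by rewrite mulr_ge0 ?sqr_ge0// addr_ge0 ?sqr_ge0//; lra.
set q := t ^+ 2 * _; rewrite (_ : _ * _ ^+ 2 = 1 + q / 4); last by rewrite /q; field.
lra.
Qed.

(* The scalar form of the Golden-Thompson inequality of the second-order cone:
   [a0 +- a] and [b0 +- b] are the eigenvalues of the two arguments, [k] is the
   cosine of the angle between their vector parts, and [b0 + b], [b0 - b] are
   small enough for [expR_le_quad]. *)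
Lemma exp_add_le k x a b a0 b0 h : -1 <= k <= 1 -> 0 <= a ->
  x ^+ 2 = a ^+ 2 + b ^+ 2 + 2 * a * b * k -> `|b0| + `|b| <= h -> h <= 3^-1 ->
  expR (a0 + b0 + x) + expR (a0 + b0 - x) <=
  (1 + h ^+ 2 + b0) * (expR (a0 + a) + expR (a0 - a)) +
  k * b * (expR (a0 + a) - expR (a0 - a)).
Proof.
move=> /andP[k1 k2] a_ge0 xE bh h3.
have quad t : `|t| <= h -> expR t <= 1 + t + h ^+ 2.
  move=> th; apply: (@le_trans _ _ (1 + t + t ^+ 2)).
    by apply: expR_le_quad; apply: le_trans h3; exact: le_trans (ler_norm _) th.
  rewrite lerD2l -real_normK ?num_real// lerXn2r ?nnegrE//.
  exact: le_trans th.
(* With this weight, [x ^+ 2] is a convex combination of its values for parallel and for opposite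
   vectors. *)
have l01 : 0 <= (1 + k) / 2 <= 1 by apply/andP; split; lra.
have xE' : x ^+ 2 = (1 + k) / 2 * (a + b) ^+ 2 + (1 - (1 + k) / 2) * (a - b) ^+ 2.
  by rewrite xE; field.
have := cosh_sqrt_convex l01 xE'.
rewrite -(ler_pM2l (expR_gt0 (a0 + b0))) mulrDr -!expRD => /le_trans; apply.
have q1 : expR (b0 + b) <= 1 + (b0 + b) + h ^+ 2.
  by apply: quad; apply: le_trans bh; exact: ler_normD.
have q2 : expR (b0 - b) <= 1 + (b0 - b) + h ^+ 2.
  by apply: quad; apply: le_trans bh; exact: ler_normB.
(* Collected this way, [expR (b0 + b)] and [expR (b0 - b)] have nonnegative coefficients, so the
   quadratic bounds can be inserted. *)
have -> : expR (a0 + b0) * ((1 + k) / 2 * (expR (a + b) + expR (- (a + b))) +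
    (1 - (1 + k) / 2) * (expR (a - b) + expR (- (a - b)))) =
    ((1 + k) / 2 * expR (a0 + a) + (1 - k) / 2 * expR (a0 - a)) * expR (b0 + b) +
    ((1 - k) / 2 * expR (a0 + a) + (1 + k) / 2 * expR (a0 - a)) * expR (b0 - b).
  by rewrite opprB !opprD !expRD; field.
set P := expR (a0 + a); set Q := expR (a0 - a).
have P0 : 0 <= P by exact: expR_ge0.
have Q0 : 0 <= Q by exact: expR_ge0.
have c1 : 0 <= (1 + k) / 2 * P + (1 - k) / 2 * Q.
  by rewrite addr_ge0// mulr_ge0//; lra.
have c2 : 0 <= (1 - k) / 2 * P + (1 + k) / 2 * Q.
  by rewrite addr_ge0// mulr_ge0//; lra.
apply: (le_trans (lerD (ler_wpM2l c1 q1) (ler_wpM2l c2 q2))).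
by rewrite le_eqVlt; apply/orP; left; apply/eqP; field.
Qed.

End Scalar.

(** * Euclidean inner product and norm *)

Section Euclidean.
Context {R : realType} {d : nat}.
Implicit Types (a b c : 'rV[R]_d) (k : R).

Definition dot a b : R := \sum_j a 0 j * b 0 j.

Lemma dotC a b : dot a b = dot b a.
Proof. by apply: eq_bigr => j _; rewrite mulrC. Qed.

Lemma dotDr a b c : dot a (b + c) = dot a b + dot a c.
Proof. by rewrite /dot -big_split; apply: eq_bigr => j _; rewrite mxE mulrDr. Qed.

Lemma dotZr k a b : dot a (k *: b) = k * dot a b.
Proof. by rewrite /dot mulr_sumr; apply: eq_bigr => j _; rewrite mxE mulrCA. Qed.

Lemma dotNr a b : dot a (- b) = - dot a b.
Proof. by rewrite -scaleN1r dotZr mulN1r. Qed.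

Lemma dotDl a b c : dot (a + b) c = dot a c + dot b c.
Proof. by rewrite dotC dotDr !(dotC c). Qed.

Lemma dotZl k a b : dot (k *: a) b = k * dot a b.
Proof. by rewrite dotC dotZr dotC. Qed.

Lemma dot0r a : dot a 0 = 0.
Proof. by rewrite -(scale0r 0) dotZr mul0r. Qed.

Lemma dot_suml (I : finType) (f : I -> 'rV[R]_d) b :
  dot (\sum_i f i) b = \sum_i dot (f i) b.
Proof.
rewrite /dot exchange_big /=; apply: eq_bigr => j _.
by rewrite summxE mulr_suml.
Qed.

Lemma l2norm_ge0 a : 0 <= l2norm a. Proof. exact: sqrtr_ge0. Qed.

Lemma l2norm_sqr a : l2norm a ^+ 2 = dot a a.
Proof.
rewrite sqr_sqrtr; last by apply: sumr_ge0 => j _; exact: sqr_ge0.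
by apply: eq_bigr => j _; rewrite expr2.
Qed.

Lemma l2norm_eq0 a : l2norm a = 0 -> a = 0.
Proof.
move=> a0; have /eqP := l2norm_sqr a; rewrite a0 expr0n /= eq_sym psumr_eq0.
  move=> /allP h; apply/rowP => j; rewrite mxE.
  by have := h j (mem_index_enum _); rewrite /= mulf_eq0 orbb => /eqP.
by move=> j _; rewrite -expr2 sqr_ge0.
Qed.

Lemma l2normZ k a : l2norm (k *: a) = `|k| * l2norm a.
Proof.
rewrite /l2norm; under eq_bigr => j _ do rewrite mxE exprMn.
by rewrite -mulr_sumr sqrtrM ?sqr_ge0// sqrtr_sqr.
Qed.

Lemma l2norm0 : l2norm (0 : 'rV[R]_d) = 0.
Proof. by rewrite -(scale0r 0) l2normZ normr0 mul0r. Qed.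

Lemma l2normN a : l2norm (- a) = l2norm a.
Proof. by rewrite -scaleN1r l2normZ normrN1 mul1r. Qed.

Lemma l2norm_distC a b : l2norm (a - b) = l2norm (b - a).
Proof. by rewrite -l2normN opprB. Qed.

Lemma dot_le a b : dot a b <= l2norm a * l2norm b.
Proof.
have [a0|a0] := eqVneq (l2norm a) 0.
  by rewrite a0 mul0r (l2norm_eq0 a0) dotC dot0r.
have [b0|b0] := eqVneq (l2norm b) 0.
  by rewrite b0 mulr0 (l2norm_eq0 b0) dot0r.
(* The Cauchy-Schwarz defect, up to a positive factor, is the square of a norm. *)
have gap : l2norm (l2norm b *: a + (- l2norm a) *: b) ^+ 2 =
    2 * (l2norm a * l2norm b) * (l2norm a * l2norm b - dot a b).
  rewrite l2norm_sqr !(dotDr, dotDl, dotZr, dotZl) (dotC b a) -!l2norm_sqr.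
  by ring.
rewrite -subr_ge0 -(pmulr_rge0 (x := 2 * (l2norm a * l2norm b))) -?gap ?sqr_ge0//.
by rewrite mulr_gt0 ?ltr0n// mulr_gt0// lt_neqAle eq_sym ?a0 ?b0 l2norm_ge0.
Qed.

Lemma dot_ge a b : - (l2norm a * l2norm b) <= dot a b.
Proof. by rewrite lerNl -dotNr (le_trans (dot_le _ _))// l2normN. Qed.

Lemma l2normD a b : l2norm (a + b) <= l2norm a + l2norm b.
Proof.
rewrite -(@ler_pXn2r _ 2) ?nnegrE ?addr_ge0 ?l2norm_ge0//.
rewrite l2norm_sqr dotDr !dotDl (dotC b a) sqrrD -!l2norm_sqr mulr2n.
by have := dot_le a b; lra.
Qed.

End Euclidean.

(** * Exponential and trace in the second-order cone *)

Section SocExp.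
Context {R : realType} {d : nat}.
Implicit Types x y : 'rV[R]_d * R.
Let c : R := (Num.sqrt 2)^-1.

Lemma sqrt2_gt0 : 0 < Num.sqrt 2 :> R. Proof. by rewrite sqrtr_gt0. Qed.

Fact soc_exp_key : unit. Proof. exact: tt. Qed.

(* If [x.1 = 0] the junk value of the division by zero is multiplied by 0.
   The pair is locked so that simplification does not unfold it. *)
Definition soc_exp x : 'rV[R]_d * R :=
  let e1 := expR (c * (x.2 + l2norm x.1)) in
  let e2 := expR (c * (x.2 - l2norm x.1)) in
  locked_with soc_exp_key
    (((e1 - e2) * c / l2norm x.1) *: x.1, (e1 + e2) * c).

Lemma soc_expE x :
  let e1 := expR (c * (x.2 + l2norm x.1)) in
  let e2 := expR (c * (x.2 - l2norm x.1)) in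
  soc_exp x = (((e1 - e2) * c / l2norm x.1) *: x.1, (e1 + e2) * c).
Proof. exact: locked_withE. Qed.

Definition soc_tr x : R := Num.sqrt 2 * x.2.

Lemma l2normE (u : 'rV[R]_d) : Num.sqrt (\sum_j u 0 j * u 0 j) = l2norm u.
Proof. by congr Num.sqrt; apply: eq_bigr => j _; rewrite expr2. Qed.

Lemma soc_expTE dir0 x : result (soc_expT dir0 x) = soc_exp x.
Proof.
rewrite /soc_expT /= l2normE soc_expE div1r -/c; congr pair; last by rewrite mulrDl.
apply/rowP => j; rewrite !mxE; case: eqP => [x0|x0] /=.
  by rewrite x0 invr0 addr0 subr0; ring.
by rewrite mxE; ring.
Qed.

Lemma soc_exp0 : soc_exp 0 = (0, Num.sqrt 2).
Proof.
rewrite soc_expE /= scaler0 l2norm0 subr0 addr0 mulr0 expR0; congr pair.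
rewrite -[1 + 1]/2%:R -[X in X * _](@sqr_sqrtr _ 2)// expr2.
by rewrite mulfK ?gt_eqF ?sqrt2_gt0.
Qed.

Lemma soc_tr_exp x : soc_tr (soc_exp x) =
  expR (c * (x.2 + l2norm x.1)) + expR (c * (x.2 - l2norm x.1)).
Proof.
by rewrite /soc_tr soc_expE /= mulrC -mulrA mulVf ?mulr1// gt_eqF ?sqrt2_gt0.
Qed.

Lemma soc_tr_exp_ge x : expR (c * (x.2 + l2norm x.1)) <= soc_tr (soc_exp x).
Proof. by rewrite soc_tr_exp lerDl expR_ge0. Qed.

Lemma soc_tr_exp_gt0 x : 0 < soc_tr (soc_exp x).
Proof. by rewrite soc_tr_exp addr_gt0 ?expR_gt0. Qed.

Lemma soc_exp_cone x : l2norm (soc_exp x).1 <= (soc_exp x).2.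
Proof.
have c0 : 0 < c by rewrite invr_gt0 sqrt2_gt0.
rewrite soc_expE /=; set e1 := expR _; set e2 := expR _.
have e2_gt0 : 0 < e2 by exact: expR_gt0.
have e21 : e2 <= e1.
  by rewrite ler_expR ler_pM2l// lerD2l; have := l2norm_ge0 x.1; lra.
have [/l2norm_eq0 ->|x0] := eqVneq (l2norm x.1) 0.
  by rewrite scaler0 l2norm0 mulr_ge0 ?(ltW c0)//; lra.
rewrite l2normZ ger0_norm; last first.
  by rewrite divr_ge0 ?l2norm_ge0// mulr_ge0 ?(ltW c0)//; lra.
by rewrite divfK// ler_pM2r//; lra.
Qed.

(* Golden-Thompson: [tr (exp (x + y)) <= <exp x, exp y>]; here [exp y] is
   moreover replaced by [1 + y + h ^+ 2], which dominates it. *)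
Lemma soc_exp_add x y (h : R) : c * (`|y.2| + l2norm y.1) <= h -> h <= 3^-1 ->
  soc_tr (soc_exp (x + y)) <= (1 + h ^+ 2) * soc_tr (soc_exp x) +
    (dot (soc_exp x).1 y.1 + (soc_exp x).2 * y.2).
Proof.
move=> yh h3; have c0 : 0 < c by rewrite invr_gt0 sqrt2_gt0.
rewrite !soc_tr_exp.
have nx := l2norm_ge0 x.1; have ny := l2norm_ge0 y.1.
(* The cosine of the angle; for a zero vector the division yields 0, and [kE] and [k1] still
   hold. *)
pose k := dot x.1 y.1 / (l2norm x.1 * l2norm y.1).
have kE : k * (l2norm x.1 * l2norm y.1) = dot x.1 y.1.
  have [/eqP|xy0] := eqVneq (l2norm x.1 * l2norm y.1) 0; last by rewrite divfK.
  rewrite mulf_eq0 => /orP[] /eqP z0.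
    by rewrite z0 mul0r mulr0 (l2norm_eq0 z0) dotC dot0r.
  by rewrite z0 !mulr0 (l2norm_eq0 z0) dot0r.
have k1 : -1 <= k <= 1.
  have [xy0|xy0] := eqVneq (l2norm x.1 * l2norm y.1) 0.
    by rewrite /k xy0 invr0 mulr0 lerN10 ler01.
  have xyp : 0 < l2norm x.1 * l2norm y.1.
    by rewrite lt_neqAle eq_sym xy0 mulr_ge0.
  by rewrite ler_pdivlMr// ler_pdivrMr// mulN1r mul1r dot_ge dot_le.
have xE : (c * l2norm (x + y).1) ^+ 2 = (c * l2norm x.1) ^+ 2 +
    (c * l2norm y.1) ^+ 2 + 2 * (c * l2norm x.1) * (c * l2norm y.1) * k.
  rewrite !exprMn (l2norm_sqr (x + y).1) /= dotDr !dotDl (dotC y.1 x.1) -!l2norm_sqr.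
  by rewrite -kE; ring.
have bh : `|c * y.2| + `|c * l2norm y.1| <= h.
  by rewrite !normrM (gtr0_norm c0) (ger0_norm ny) -mulrDr.
have cx0 : 0 <= c * l2norm x.1 by rewrite mulr_ge0// ltW.
have := exp_add_le (c * x.2) k1 cx0 xE bh h3.
rewrite -!mulrDr -!mulrBr => /le_trans; apply.
rewrite le_eqVlt; apply/orP; left; apply/eqP => /=.
set e1 := expR _; set e2 := expR _.
rewrite soc_expE /= -/e1 -/e2.
have -> : dot (((e1 - e2) * c / l2norm x.1) *: x.1) y.1 =
    (e1 - e2) * c * (k * l2norm y.1).
  rewrite dotZl -kE.
  have [x0|x0] := eqVneq (l2norm x.1) 0; last by field.
  by rewrite /k x0 !(mul0r, mulr0, invr0).
by ring.
Qed.

End SocExp.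

(** * Iterations of the test: potential and invariant *)

Lemma result_bind (A B : Type) (x : timed A) (f : A -> timed B) :
  result (bind x f) = result (f (result x)).
Proof. by []. Qed.

Lemma result_tabT (A : Type) (k : nat) (f : 'I_k -> timed A) i :
  result (tabT f) i = result (f i).
Proof. by []. Qed.

Section Correctness.
Context {R : realType} {d m : nat}.
Variables (v : 'I_m.+1 -> 'rV[R]_d) (gam : 'I_m.+1 -> R).
Let v1 := v ord0.
Let gam1 := gam ord0.
Let vs (i : 'I_m) := v (lift ord0 i).
Let gams (i : 'I_m) := gam (lift ord0 i).
Implicit Types (S u : 'rV[R]_d) (p : 'I_m -> 'rV[R]_d * R).

Definition trace_one p := \sum_i soc_tr (p i) = 1.
Definition in_cone p := forall i, l2norm (p i).1 <= (p i).2.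

(** Trace one means that the last components sum to [1 / Num.sqrt 2], so the term in the radius
    splits over the cones and the value becomes the pairing of [p] with the slacks. *)
Lemma sub_valueE p u a : trace_one p -> sub_value v gam p u a =
  \sum_i (dot (p i).1 (u - vs i) + (p i).2 * (a - gams i)).
Proof.
move=> p1; rewrite /sub_value.
rewrite -[\sum_j (\sum_i (p i).1) 0 j * _]/(dot (\sum_i (p i).1) u).
have -> : a / Num.sqrt 2 = \sum_i (p i).2 * a.
  apply: (@mulfI _ (Num.sqrt 2)); first by rewrite gt_eqF ?sqrt2_gt0.
  rewrite mulrCA divff ?gt_eqF ?sqrt2_gt0// -mulr_suml mulrA mulr_sumr.
  by rewrite -[\sum_i _]/(\sum_i soc_tr (p i)) p1 mul1r mulr1.
rewrite dot_suml -big_split -!sumrB /=; apply: eq_bigr => i _.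
rewrite dotDr dotNr -[\sum_j _]/(dot (vs i) (p i).1) (dotC (vs i)).
by rewrite -/(gams i); ring.
Qed.

Lemma sum_divTE p a (i : 'I_m) :
  result (sum_divT p a) i = (a^-1 *: (p i).1, (p i).2 / a).
Proof. by congr pair; apply/rowP => j; rewrite !mxE mulrC. Qed.

(** The slacks of an enclosing sphere lie in the cones, and two elements of a second-order cone have
    nonnegative pairing. *)
Lemma encloses_sub_value p u a : trace_one p -> in_cone p ->
  encloses v gam u a -> 0 <= sub_value v gam p u a.
Proof.
move=> p1 pc ua; rewrite sub_valueE//; apply: sumr_ge0 => i _.
have := dot_ge (p i).1 (u - vs i); have := ua (lift ord0 i).
rewrite -/(vs i) -/(gams i) => h1 h2.
have h3 : l2norm (p i).1 * l2norm (u - vs i) <= (p i).2 * (a - gams i).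
  by rewrite ler_pM ?l2norm_ge0.
lra.
Qed.

Variables (dir0 : 'rV[R]_d) (alpha eta rho : R) (tie : nat -> 'rV[R]_d).

(* The loss of [n] iterations with centers of sum [S], times [- eta / rho]. *)
Definition loss S (n : R) (i : 'I_m) : 'rV[R]_d * R :=
  ((- (eta / rho)) *: (S - n *: vs i), (- (eta / rho)) * (n * (alpha - gams i))).

Definition potential S n : R := \sum_i soc_tr (soc_exp (loss S n i)).

(** The point available after [n] iterations, that is p^(n+1); the potential is the normalizer C. *)
Definition iterate S n (i : 'I_m) : 'rV[R]_d * R :=
  ((potential S n)^-1 *: (soc_exp (loss S n i)).1,
   (soc_exp (loss S n i)).2 / potential S n).

Hypothesis m_gt0 : (0 < m)%N.

Lemma potential_ge S n i : soc_tr (soc_exp (loss S n i)) <= potential S n.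
Proof.
rewrite /potential (bigD1 i)//= lerDl; apply: sumr_ge0 => j _.
exact/ltW/soc_tr_exp_gt0.
Qed.

Lemma potential_gt0 S n : 0 < potential S n.
Proof.
exact: lt_le_trans (soc_tr_exp_gt0 _) (potential_ge S n (Ordinal m_gt0)).
Qed.

Lemma potential0 : potential 0 0 = 2 * m%:R.
Proof.
rewrite /potential (eq_bigr (fun=> 2)) => [|i _].
  by rewrite sumr_const card_ord mulr_natr.
rewrite /loss scale0r mul0r subr0 scaler0 mulr0 (_ : (0, 0) = 0)// soc_exp0.
by rewrite /soc_tr -expr2 sqr_sqrtr.
Qed.

Lemma iterate_trace_one S n : trace_one (iterate S n).
Proof.
rewrite /trace_one /soc_tr /=; under eq_bigr do rewrite mulrA.
by rewrite -mulr_suml -/(potential S n) divff// gt_eqF ?potential_gt0.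
Qed.

Lemma iterate_in_cone S n : in_cone (iterate S n).
Proof.
move=> i; have P0 := potential_gt0 S n; rewrite /iterate /=.
rewrite l2normZ gtr0_norm ?invr_gt0// [leRHS]mulrC ler_pM2l ?invr_gt0//.
exact: soc_exp_cone.
Qed.

Hypothesis rho_gt0 : 0 < rho.

(** The factor [n] in the exponent cancels the averaging, leaving the accumulated loss. *)
Lemma nextTE S (n : R) : n != 0 ->
  result (nextT v gam dir0 alpha eta rho n (n^-1 *: S)) = iterate S n.
Proof.
move=> n0; rewrite /nextT !result_bind.
set x := result (tabT _).
have -> : x = fun i => soc_exp (loss S n i).
  apply/funext => i; rewrite /x result_tabT !result_bind soc_expTE.
  congr soc_exp; congr pair => /=; last by rewrite -/(gams i); ring.
  by apply/rowP => j; rewrite !mxE -/(vs i); field; rewrite n0 gt_eqF.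
by apply/funext => i; rewrite sum_divTE.
Qed.

Hypotheses (eta_ge0 : 0 <= eta) (eta_le : eta <= 3^-1).
Hypothesis width : forall u i, l2norm (u - v1) <= alpha - gam1 ->
  `|alpha - gams i| + l2norm (u - vs i) <= Num.sqrt 2 * rho.

Lemma potential_step S n u : l2norm (u - v1) <= alpha - gam1 ->
  0 <= sub_value v gam (iterate S n) u alpha ->
  potential (S + u) (n + 1) <= (1 + eta ^+ 2) * potential S n.
Proof.
move=> u1 val.
have er : 0 <= eta / rho by rewrite divr_ge0// ltW.
have P0 := potential_gt0 S n.
pose y i := loss u 1 i.
have step i : soc_tr (soc_exp (loss (S + u) (n + 1) i)) <=
    (1 + eta ^+ 2) * soc_tr (soc_exp (loss S n i)) - eta / rho * potential S n *
    (dot (iterate S n i).1 (u - vs i) + (iterate S n i).2 * (alpha - gams i)).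
  have -> : loss (S + u) (n + 1) i = loss S n i + y i.
    congr pair => /=; last by ring.
    by apply/rowP => j; rewrite !mxE; ring.
  (* [width] bounds the eigenvalues of one loss by [rho]; the scaling by [eta / rho] brings them
     below [eta]. *)
  have yh : (Num.sqrt 2)^-1 * (`|(y i).2| + l2norm (y i).1) <= eta.
    rewrite /= scale1r mul1r l2normZ normrM normrN (ger0_norm er) -mulrDr.
    rewrite mulrCA -mulrA ler_piMr// ler_pdivrMl// ler_pdivrMl ?sqrt2_gt0//.
    by rewrite mulr1 width.
  apply: (le_trans (soc_exp_add (loss S n i) yh eta_le)).
  rewrite lerD2l /= scale1r mul1r.
  rewrite dotZr [dot (_^-1 *: _) _]dotZl.
  by rewrite le_eqVlt; apply/orP; left; apply/eqP; field; rewrite !gt_eqF.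
apply: (le_trans (ler_sum _ (fun i _ => step i))).
rewrite sumrB -mulr_sumr -/(potential S n) -mulr_sumr -sub_valueE.
  by rewrite gerBl mulr_ge0// mulr_ge0// ltW.
exact: iterate_trace_one.
Qed.

Section Iterations.
Variable eps : R.

Lemma iterTS k t (n : R) p S ubar :
  result (iterT v gam dir0 alpha eps eta rho tie k.+1 t n p S ubar) =
  if result (solveT v gam alpha p (tie t)) is Some u then
    result (iterT v gam dir0 alpha eps eta rho tie k t.+1 (n + 1)
      (result (nextT v gam dir0 alpha eta rho n (n^-1 *: (S + u))))
      (S + u) (n^-1 *: (S + u)))
  else None.
Proof.
cbn [iterT]; rewrite result_bind; case: (result (solveT _ _ _ _ _)) => [u|//].
rewrite 4!result_bind.
have -> : result (addV S u) = S + u by apply/rowP => j; rewrite !mxE.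
have -> : result (divV (S + u) n) = n^-1 *: (S + u).
  by apply/rowP => j; rewrite !mxE mulrC.
by [].
Qed.

Hypothesis tie_le1 : forall t, l2norm (tie t) <= 1.

(** Loop invariant after [n] iterations, the counter being already [n.+1]. For [n = 0] the average
    is the junk value 0, which matches the initial call. The constraint of the first sphere is
    carried along because it survives averaging. *)
Lemma iterT_correct k (n t : nat) S :
  l2norm (S - n%:R *: v1) <= n%:R * (alpha - gam1) ->
  match result (iterT v gam dir0 alpha eps eta rho tie k t n.+1%:R
                  (iterate S n%:R) S (n%:R^-1 *: S)) with
  | Some (u, rad) => rad = (1 + eps) * alpha /\
      exists S', [/\ u = (n + k)%:R^-1 *: S',
        l2norm (S' - (n + k)%:R *: v1) <= (n + k)%:R * (alpha - gam1) &
        potential S' (n + k)%:R <= (1 + eta ^+ 2) ^+ k * potential S n%:R]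
  | None => forall u, ~ encloses v gam u alpha
  end.
Proof.
elim: k n t S => [|k IH] n t S Sn.
  by split => //; exists S; rewrite addn0 expr0 mul1r.
rewrite iterTS.
case E: (result (solveT _ _ _ _ _)) => [u|]; last first.
  move=> u ua.
  (* An enclosing sphere would be a feasible point of nonnegative value. *)
  have /solveT_NoneP := E => /(_ (tie_le1 t)) /(_ u alpha).
  have h0 := encloses_sub_value (iterate_trace_one S n%:R)
    (iterate_in_cone S n%:R) ua.
  by rewrite ltNge h0 => /(_ (conj (lexx _) (ua ord0))).
have [[[_ u1] _] val] : sub_optimal v gam alpha (iterate S n%:R) u alpha /\
    0 <= sub_value v gam (iterate S n%:R) u alpha.
  by apply/solveT_SomeP; exists (tie t).
cbv iota; rewrite nextTE ?pnatr_eq0// natr1.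
have Sn' : l2norm (S + u - n.+1%:R *: v1) <= n.+1%:R * (alpha - gam1).
  rewrite (_ : _ - _ = (S - n%:R *: v1) + (u - v1)); last first.
    by apply/rowP => j; rewrite !mxE -natr1; ring.
  by apply: (le_trans (l2normD _ _)); rewrite -natr1 mulrDl mul1r lerD.
have := IH n.+1 t.+1 (S + u) Sn'.
case: (result _) => [[c rad]|//] [-> [S' [-> h1 h2]]]; split; first by [].
exists S'; rewrite addnS -addSn; split; [by []|exact: h1|].
apply: (le_trans h2); rewrite (exprSr _ k) -mulrA.
apply: ler_wpM2l; first by rewrite exprn_ge0// addr_ge0// sqr_ge0.
by rewrite -natr1; apply: potential_step.
Qed.

End Iterations.

End Correctness.

(** * Correctness of the feasibility test *)

Section Test.
Context {R : realType} {d m : nat}.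
Variables (v : 'I_m.+1 -> 'rV[R]_d) (gam : 'I_m.+1 -> R).
Variables (dir0 : 'rV[R]_d) (D alpha eps : R) (tie : nat -> 'rV[R]_d).
Let lnr : R := ln (2 * m%:R).
Let rho : R := 3 * D / Num.sqrt 2.

(** The iteration number T of the algorithm, where 4 R^2 rho^2 simplifies to 36 D^2. *)
Definition rounds : nat := `|Num.ceil (36 * D ^+ 2 * lnr / (eps * alpha) ^+ 2)|%N.

Let eta : R := Num.sqrt (lnr / rounds%:R).

Lemma rank_sumE : 2 * \sum_(i < m) 1 = 2 * m%:R :> R.
Proof. by rewrite sumr_const card_ord. Qed.

Lemma rounds_argE : 4 * (Num.sqrt 2 * Num.sqrt 2) * (rho * rho) * lnr /
  (eps * eps * (alpha * alpha)) = 36 * D ^+ 2 * lnr / (eps * alpha) ^+ 2.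
Proof.
have s2 : Num.sqrt 2 * Num.sqrt 2 = 2 :> R by rewrite -expr2 sqr_sqrtr.
rewrite (_ : eps * eps * _ = (eps * alpha) ^+ 2); last by ring.
congr (_ / _); rewrite /rho s2 mulf_div s2; by field.
Qed.

Lemma testTE : result (testT v gam dir0 D alpha eps tie) =
  result (iterT v gam dir0 alpha eps eta rho tie rounds 1 1
    (result (sum_divT (fun _ : 'I_m => (0, Num.sqrt 2)) (2 * m%:R))) 0 0).
Proof.
rewrite /testT 8!result_bind.
have -> : result (mulT (ret 2) (sumT (fun _ : 'I_m => ret 1))) = 2 * m%:R :> R.
  exact: rank_sumE.
set T := ceilT _; have -> : result T = rounds by rewrite /rounds -rounds_argE.
by [].
Qed.

Hypotheses (m_gt0 : (0 < m)%N) (D_gt0 : 0 < D).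
Hypotheses (alpha_gt0 : 0 < alpha) (eps_gt0 : 0 < eps).

Lemma lnr_gt0 : 0 < lnr.
Proof. by rewrite ln_gt0// -natrM ltr1n; lia. Qed.

Let X := 36 * D ^+ 2 * lnr / (eps * alpha) ^+ 2.

Let X_gt0 : 0 < X.
Proof.
by rewrite divr_gt0// ?exprn_gt0// ?mulr_gt0// ?exprn_gt0// lnr_gt0.
Qed.

Let roundsE : rounds%:R = (Num.ceil X)%:~R :> R.
Proof. by rewrite natr_absz ger0_norm// ltW// ceil_gt0. Qed.

Lemma rounds_ge : X <= rounds%:R.
Proof. by rewrite roundsE ceil_ge. Qed.

Lemma rounds_le : rounds%:R <= X + 1.
Proof. by rewrite roundsE; have := ceilB1_lt X; rewrite intrD; lra. Qed.

Lemma rounds_gt0 : 0 < rounds%:R :> R.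
Proof. exact: lt_le_trans X_gt0 rounds_ge. Qed.

Hypothesis eps_alpha_le : eps * alpha <= D.

(** Makes [eta] small enough for the quadratic bound on the exponential. *)
Lemma lnr_le : 36 * lnr <= rounds%:R.
Proof.
apply: le_trans rounds_ge; rewrite ler_pdivlMr ?exprn_gt0 ?mulr_gt0//.
rewrite (mulrAC 36) ler_pM2r ?lnr_gt0// ler_pM2l// lerXn2r ?nnegrE//.
  by rewrite mulr_ge0// ltW.
exact: ltW.
Qed.

Let eta_sqr : eta ^+ 2 = lnr / rounds%:R.
Proof. by rewrite sqr_sqrtr// divr_ge0// ?ltW ?lnr_gt0 ?rounds_gt0. Qed.

Let eta_ge0 : 0 <= eta. Proof. exact: sqrtr_ge0. Qed.

Let eta_le : eta <= 3^-1.
Proof.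
rewrite -(@ler_pXn2r _ 2) ?nnegrE ?invr_ge0// eta_sqr ler_pdivrMr ?rounds_gt0//.
by have := lnr_le; have := lnr_gt0; rewrite expr2 -invfM; lra.
Qed.

Hypothesis alpha_le : alpha <= D.
Hypothesis gam_ge0 : forall i, 0 <= gam i.
Hypothesis diam_le : forall i : 'I_m,
  l2norm (v ord0 - v (lift ord0 i)) + gam ord0 + gam (lift ord0 i) <= D.

(** The right side is 3 D: the radius term is at most D, and going through the first center bounds
    the distance by 2 D. *)
Let width (u : 'rV[R]_d) (i : 'I_m) : l2norm (u - v ord0) <= alpha - gam ord0 ->
  `|alpha - gam (lift ord0 i)| + l2norm (u - v (lift ord0 i)) <= Num.sqrt 2 * rho.
Proof.
move=> u1; rewrite /rho mulrC divfK ?gt_eqF ?sqrt2_gt0//.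
have := l2normD (u - v ord0) (v ord0 - v (lift ord0 i)); rewrite addrA subrK.
have := diam_le i; have := gam_ge0 ord0; have := gam_ge0 (lift ord0 i).
have := l2norm_ge0 (v ord0 - v (lift ord0 i)); have := alpha_le; have := alpha_gt0.
move=> h1 h2 h3 h4 h5 h6 h7.
have : `|alpha - gam (lift ord0 i)| <= D.
  by rewrite ler_norml; apply/andP; split; lra.
lra.
Qed.

Let rho_gt0 : 0 < rho.
Proof. by rewrite divr_gt0 ?sqrt2_gt0// mulr_gt0. Qed.

Let first_iterate : result (sum_divT (fun _ : 'I_m => (0, Num.sqrt 2)) (2 * m%:R)) =
  iterate v gam alpha eta rho 0 0.
Proof.
apply/funext => i; rewrite sum_divTE /iterate potential0.
suff -> : soc_exp (loss v gam alpha eta rho 0 0 i) = (0, Num.sqrt 2) by [].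
rewrite /loss scale0r mul0r subr0 scaler0 mulr0 (_ : (0, 0) = 0)//.
exact: soc_exp0.
Qed.

Hypothesis tie_le1 : forall t, l2norm (tie t) <= 1.

Lemma testT_correct : match result (testT v gam dir0 D alpha eps tie) with
  | Some (u, rad) => rad = (1 + eps) * alpha /\ encloses v gam u rad
  | None => forall u, ~ encloses v gam u alpha
  end.
Proof.
have T0 := rounds_gt0; have T0' : rounds%:R != 0 :> R by rewrite gt_eqF.
have L0 := lnr_gt0.
rewrite testTE first_iterate.
have S0 : l2norm (0 - 0%:R *: v ord0) <= 0%:R * (alpha - gam ord0).
  by rewrite mulr0n scale0r subr0 l2norm0 mul0r.
have := iterT_correct dir0 m_gt0 rho_gt0 eta_ge0 eta_le width eps tie_le1
  rounds 1 S0.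
rewrite scaler0; case: (result _) => [[u rad]|//] [-> [S [uE Sn pot]]].
rewrite add0n in uE Sn pot.
have uv w : l2norm (S - rounds%:R *: w) = rounds%:R * l2norm (u - w).
  rewrite -[X in X * l2norm _](ger0_norm (ltW T0)) -l2normZ uE scalerBr scalerA.
  by rewrite divff// scale1r.
split=> // i; have ea : 0 <= eps * alpha by rewrite mulr_ge0// ltW.
have [<-|/unlift_some[i' -> _]] := eqVneq ord0 i.
  have : l2norm (u - v ord0) <= alpha - gam ord0 by rewrite -(ler_pM2l T0) -uv.
  by move=> /le_trans; apply; rewrite lerD2r mulrDl mul1r lerDl.
set w := v _; set g := gam _.
pose z := l2norm (u - w) - (alpha - g).
suff : z <= eps * alpha.
  by rewrite /z lerBlDl addrAC => /le_trans; apply; rewrite mulrDl mul1r.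
rewrite leNgt; apply/negP => zgt; have z0 := le_lt_trans ea zgt.
(* One factor r is the initial potential; the other is [expR (eta ^+ 2 * T)], which dominates the
   growth. *)
have pot' : potential v gam alpha eta rho S rounds%:R <= (2 * m%:R) * (2 * m%:R).
  apply: (le_trans pot); rewrite potential0 ler_wpM2r ?mulr_ge0//.
  apply: (@le_trans _ _ (expR (eta ^+ 2) ^+ rounds)).
    by rewrite lerXn2r ?nnegrE ?expR_ge0 ?expR_ge1Dx// addr_ge0// sqr_ge0.
  rewrite -expRM_natl eta_sqr mulrC divfK// lnK// posrE.
  by rewrite mulr_gt0// ltr0n.
have er : 0 <= eta / rho by exact: divr_ge0 eta_ge0 (ltW rho_gt0).
have m0 : 0 < 2 * m%:R :> R by rewrite mulr_gt0// ltr0n.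
have := le_trans (soc_tr_exp_ge _)
  (le_trans (potential_ge v gam alpha eta rho S rounds%:R i') pot').
rewrite /loss /= l2normZ normrN (ger0_norm er).
rewrite -/w -/g uv -(lnK (x := 2 * m%:R)) ?posrE// -expRD ler_expR -/lnr => h.
(* [K * z] is the larger eigenvalue of the accumulated loss, [z] being the violation of constraint
   [i']. Since [z] is positive, the bound [2 * lnr] may be squared, which removes the roots. *)
pose K : R := (Num.sqrt 2)^-1 * (eta / rho) * rounds%:R.
have K0 : 0 <= K by rewrite !mulr_ge0 ?invr_ge0// ltW.
have Kz : K * z <= lnr + lnr.
  apply: le_trans h; rewrite le_eqVlt; apply/orP; left; apply/eqP.
  by rewrite /K /z; ring.
have K2 : K ^+ 2 = lnr * rounds%:R / (9 * D ^+ 2).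
  rewrite /K !exprMn !exprVn eta_sqr (@sqr_sqrtr _ 2)// /rho !exprMn exprVn.
  by rewrite (@sqr_sqrtr _ 2)//; field; rewrite T0' gt_eqF.
have : (K * z) ^+ 2 <= (lnr + lnr) ^+ 2.
  have [z0' L0'] := (ltW z0, ltW L0).
  by apply: lerXn2r Kz; rewrite nnegrE; [exact: mulr_ge0|exact: addr_ge0].
rewrite exprMn K2 leNgt => /negP; apply.
(* By the choice of T, a violation above [eps * alpha] forces [(K * z) ^+ 2] above
   [(2 * lnr) ^+ 2]. *)
have := rounds_ge; rewrite /X ler_pdivrMr ?exprn_gt0 ?mulr_gt0// => h1.
have h2 : rounds%:R * (eps * alpha) ^+ 2 < rounds%:R * z ^+ 2.
  by rewrite ltr_pM2l// ltrXn2r// nnegrE ltW.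
have := le_lt_trans h1 h2; rewrite -(ltr_pM2r L0) => h3.
rewrite mulrAC ltr_pdivlMr ?mulr_gt0 ?exprn_gt0//.
have -> : (lnr + lnr) ^+ 2 * (9 * D ^+ 2) = 36 * D ^+ 2 * lnr * lnr by ring.
by rewrite (lt_le_trans h3)// mulrC mulrA.
Qed.

End Test.

(** * Operation counts *)

Lemma ops_bind (A B : Type) (x : timed A) (f : A -> timed B) :
  ops (bind x f) = (ops x + ops (f (result x)))%N.
Proof. by []. Qed.

Lemma leq_ops_bind (A B : Type) (x : timed A) (f : A -> timed B) (a b : nat) :
  (ops x <= a)%N -> (ops (f (result x)) <= b)%N -> (ops (bind x f) <= a + b)%N.
Proof. exact: leq_add. Qed.

Lemma leq_sum_ord (k : nat) (f : 'I_k -> nat) (c : nat) :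
  (forall i, f i <= c)%N -> (\sum_i f i <= k * c)%N.
Proof.
by move=> fc; rewrite -[k in (k * _)%N]card_ord -sum_nat_const leq_sum.
Qed.

Section Costs.
Context {R : realType} {d m : nat}.
Variables (v : 'I_m.+1 -> 'rV[R]_d) (gam : 'I_m.+1 -> R) (dir0 : 'rV[R]_d).
Implicit Types (u w : 'rV[R]_d) (a : R) (p : 'I_m -> 'rV[R]_d * R).

Lemma ops_normT u : (ops (normT u) <= 2 * d + 1)%N.
Proof. by rewrite /= addn1 ltnS mulnC; apply: leq_sum_ord. Qed.

Lemma ops_dotT u w : (ops (dotT u w) <= 2 * d)%N.
Proof. by rewrite mulnC; apply: leq_sum_ord. Qed.

Lemma ops_divV u a : (ops (divV u a) <= d)%N.
Proof. by rewrite -[leqRHS]muln1; apply: leq_sum_ord. Qed.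

Lemma ops_addV u w : (ops (addV u w) <= d)%N.
Proof. by rewrite -[leqRHS]muln1; apply: leq_sum_ord. Qed.

Lemma ops_subV u w : (ops (subV u w) <= d)%N.
Proof. by rewrite -[leqRHS]muln1; apply: leq_sum_ord. Qed.

Lemma ops_ifT (b : bool) u w a : (ops (if b then ret u else divV w a) <= d)%N.
Proof. by case: b => //; exact: ops_divV. Qed.

Lemma ops_soc_expT (x : 'rV[R]_d * R) : (ops (soc_expT dir0 x) <= 9 * d + 13)%N.
Proof.
(* One summand per [let!], in program order; the later counts follow the same pattern. *)
apply: (@leq_trans ((2 * d + 1) + (1 + (d + (2 + (3 + (3 + (d * 6 + 3)))))))); last by lia.
apply: leq_ops_bind; first exact: ops_normT.
apply: leq_ops_bind => //; apply: leq_ops_bind; first exact: ops_ifT.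
do 3!apply: leq_ops_bind => //.
by apply: leq_ops_bind => //; exact: leq_sum_ord.
Qed.

Lemma ops_sum_divT p a : (ops (sum_divT p a) <= m * (d + 1))%N.
Proof.
apply: leq_sum_ord => i; apply: leq_ops_bind => //; exact: ops_divV.
Qed.

Lemma ops_nextT alpha eta rho t u :
  (ops (nextT v gam dir0 alpha eta rho t u) <= 12 * (m * d) + 19 * m + 3)%N.
Proof.
apply: (@leq_trans (3 + (m * ((d * 2) + (2 + (9 * d + 13))) +
  (m * 3 + m * (d + 1)))))%N; last by lia.
apply: leq_ops_bind => //; apply: leq_ops_bind.
  apply: leq_sum_ord => i; apply: leq_ops_bind; first exact: leq_sum_ord.
  by apply: leq_ops_bind => //; exact: ops_soc_expT.
by apply: leq_ops_bind; [exact: leq_sum_ord|exact: ops_sum_divT].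
Qed.

Lemma ops_solveT alpha p u :
  (ops (solveT v gam alpha p u) <= 3 * (m * d) + 3 * m + 8 * d + 9)%N.
Proof.
apply: (@leq_trans (1 + (d * m + ((2 * d + 1) + (1 + (d + (d * 3 +
  ((2 * d + 2 + m * (2 * d + 1) + m * 2 + 3) + (1 + 0)))))))))%N; last by lia.
apply: leq_ops_bind => //; case: ifP => // _.
apply: leq_ops_bind.
  by apply: leq_sum_ord => j; rewrite -[leqRHS]muln1; exact: leq_sum_ord.
apply: leq_ops_bind; first exact: ops_normT.
apply: leq_ops_bind => //; apply: leq_ops_bind; first exact: ops_ifT.
apply: leq_ops_bind; first exact: leq_sum_ord.
apply: leq_ops_bind; last by apply: leq_ops_bind => //; case: ifP.
set u' := result _; set W := result _.
have h1 := ops_dotT W u'.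
have h2 : (\sum_i (ops (dotT (v (lift ord0 i)) (p i).1)).+1 <= m * (2 * d + 1))%N.
  by apply: leq_sum_ord => i; rewrite addn1 ltnS ops_dotT.
have h3 : (\sum_(i < m) 2 <= m * 2)%N by exact: leq_sum_ord.
rewrite -[leqLHS]/((((ops (dotT W u') + 2).+1 +
  \sum_i (ops (dotT (v (lift ord0 i)) (p i).1)).+1).+1 + \sum_(i < m) 2).+1)%N.
lia.
Qed.

Hypotheses (m_gt0 : (0 < m)%N) (d_gt0 : (0 < d)%N).

Lemma ops_iterT alpha eps eta rho tie k t n p S u :
  (ops (iterT v gam dir0 alpha eps eta rho tie k t n p S u) <=
   60 * (m * d) * k + 2)%N.
Proof.
elim: k t n p S u => [|k IH] t n p S u; first by rewrite muln0.
(* The coefficients of one iteration add up to 60, and [m], [d] and 1 are at most [m * d]. *)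
apply: (@leq_trans ((3 * (m * d) + 3 * m + 8 * d + 9) + (d + (d +
   ((12 * (m * d) + 19 * m + 3) + (1 + (60 * (m * d) * k + 2)))))))%N; last first.
  have h1 : (d <= m * d)%N by rewrite leq_pmull.
  have h2 : (m <= m * d)%N by rewrite leq_pmulr.
  by rewrite mulnS; lia.
cbn [iterT]; apply: leq_ops_bind; first exact: ops_solveT.
case: (result _) => [u'|//].
apply: leq_ops_bind; first exact: ops_addV.
apply: leq_ops_bind; first exact: ops_divV.
apply: leq_ops_bind; first exact: ops_nextT.
by apply: leq_ops_bind => //; exact: IH.
Qed.

(** Counting up to the ceiling costs two operations per unit, which turns 60 into 62. *)
Lemma ops_testT D alpha eps tie : (ops (testT v gam dir0 D alpha eps tie) <=
  62 * (m * d) * @rounds R m D alpha eps + 24 * (m * d))%N.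
Proof.
set T := rounds _ _ _.
apply: (@leq_trans ((m + 1) + (1 + (3 + (1 + ((9 + T.*2.+1) + (2 + (1 +
  (m * (d + 1) + (60 * (m * d) * T + 2)))))))))%N); last first.
  have h1 : (d <= m * d)%N by rewrite leq_pmull.
  have h2 : (m <= m * d)%N by rewrite leq_pmulr.
  have h3 : (T <= m * d * T)%N by rewrite leq_pmull// muln_gt0 m_gt0.
  by rewrite -!mulnA; lia.
apply: leq_ops_bind.
  by rewrite /= addn1 ltnS add0n -[leqRHS]muln1; exact: leq_sum_ord.
have -> : result (mulT (ret 2) (sumT (fun _ : 'I_m => ret 1))) = 2 * m%:R :> R.
  exact: rank_sumE.
do 3!apply: leq_ops_bind => //.
set t := ceilT _.
have tE : result t = T by rewrite /T /rounds -rounds_argE.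
apply: leq_ops_bind; first by rewrite -tE.
rewrite tE; do 2!apply: leq_ops_bind => //.
apply: leq_ops_bind; first exact: ops_sum_divT.
exact: ops_iterT.
Qed.

Lemma ops_diamT : (ops (diamT v gam) <= 7 * (m * d))%N.
Proof.
have h2 : (m <= m * d)%N by rewrite leq_pmulr.
apply: (@leq_trans (m * ((d + ((2 * d + 1) + 2)) + 1))%N); last by lia.
apply: leq_sum_ord => i; rewrite addn1 ltnS.
apply: leq_ops_bind; first exact: ops_subV.
set x := result _.
rewrite -[leqLHS]/(((ops (normT x) + 0).+1 + 0).+1)%N.
by have := ops_normT x; lia.
Qed.

End Costs.

(** * Bounds on the optimal radius *)

Section Optimum.
Context {R : realType} {d m : nat}.
Variables (v : 'I_m.+1 -> 'rV[R]_d) (gam : 'I_m.+1 -> R).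
Hypothesis gam_ge0 : forall i, 0 <= gam i.

Definition diam : R := \big[Num.max/0]_(i < m)
  (l2norm (v ord0 - v (lift ord0 i)) + gam ord0 + gam (lift ord0 i)).

Lemma diamTE : result (diamT v gam) = diam.
Proof.
rewrite -[LHS]/(\big[Num.max/0]_(i < m)
  (l2norm (result (subV (v ord0) (v (lift ord0 i)))) + gam ord0 + gam (lift ord0 i))).
apply: eq_bigr => i _; congr (l2norm _ + _ + _).
by apply/rowP => j; rewrite !mxE.
Qed.

Lemma diam_ge i :
  l2norm (v ord0 - v (lift ord0 i)) + gam ord0 + gam (lift ord0 i) <= diam.
Proof. exact: le_bigmax. Qed.

Lemma diam_ge0 : 0 <= diam.
Proof. exact: bigmax_ge_id. Qed.

(** Triangle inequality through [u]; the default 0 of the maximum needs [0 <= g], which the first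
    sphere provides. *)
Lemma encloses_radius_ge u g : encloses v gam u g -> diam / 2 <= g.
Proof.
move=> ug; have g0 := ug ord0; have n0 := l2norm_ge0 (u - v ord0).
have p0 := gam_ge0 ord0.
rewrite ler_pdivrMr//; apply: bigmax_le => [|i _]; first by lra.
have := l2normD (v ord0 - u) (u - v (lift ord0 i)).
have := ug (lift ord0 i); rewrite addrA subrK (l2norm_distC (v ord0)).
lra.
Qed.

Lemma encloses_diam : (0 < m)%N -> encloses v gam (v ord0) diam.
Proof.
move=> m_gt0 i; have [<-|/unlift_some[j -> _]] := eqVneq ord0 i.
  (* The maximum ranges over the other spheres, so one of them is needed to get
     [gam ord0 <= diam]. *)
  rewrite subrr l2norm0; have := diam_ge (Ordinal m_gt0).
  have := l2norm_ge0 (v ord0 - v (lift ord0 (Ordinal m_gt0))).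
  have := gam_ge0 (lift ord0 (Ordinal m_gt0)).
  lra.
by have := diam_ge j; have := gam_ge0 ord0; lra.
Qed.

Let encloses_lb : has_lbound [set g | exists u, encloses v gam u g].
Proof. by exists (diam / 2) => g [u /encloses_radius_ge]. Qed.

Lemma ses_opt_le u g : encloses v gam u g -> ses_opt v gam <= g.
Proof. by move=> ug; apply: ge_inf => //; exists u. Qed.

(** Enclosure persists when the radius grows, so every enclosing radius is at least [a];
    [encloses_diam] makes the infimum one of a nonempty set. *)
Lemma ses_opt_ge a : (0 < m)%N -> (forall u, ~ encloses v gam u a) ->
  a <= ses_opt v gam.
Proof.
move=> m_gt0 na; apply: lb_le_inf.
  by exists diam, (v ord0); exact: encloses_diam.
move=> g [u ug]; rewrite leNgt; apply/negP => ga; apply: (na u) => i.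
by rewrite (le_trans (ug i))// lerD2r ltW.
Qed.

Lemma ses_opt_ge_diam : (0 < m)%N -> diam / 2 <= ses_opt v gam.
Proof.
move=> m_gt0; apply: lb_le_inf.
  by exists diam, (v ord0); exact: encloses_diam.
by move=> g [u /encloses_radius_ge].
Qed.

Lemma ses_opt_le_diam : (0 < m)%N -> ses_opt v gam <= diam.
Proof. by move=> m_gt0; exact: ses_opt_le (encloses_diam m_gt0). Qed.

End Optimum.

(** * Logarithm of the rank r = 2 (n - 1) *)

Lemma ln2_ge (R : realType) : 2^-1 <= ln 2 :> R.
Proof.
rewrite -ler_expR lnK ?posrE//.
have := expR_ge1Dx (- 2^-1 : R); have := expRxMexpNx_1 (2^-1 : R).
have := expR_gt0 (2^-1 : R).
set e := expR _; set e' := expR _ => e0 ee e'2.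
have h : e * 2^-1 <= e * e' by rewrite ler_pM2l//; lra.
rewrite ee in h; lra.
Qed.

(** From [2 * m <= m.+1 ^ 2]; replaces ln r by ln n in the final bound. *)
Lemma ln_rank_le (R : realType) (m : nat) : (0 < m)%N ->
  ln (2 * m%:R) <= 2 * ln m.+1%:R :> R.
Proof.
move=> m_gt0; rewrite [leRHS]mulr_natl -lnXn ?ltr0n//.
rewrite ler_ln ?posrE ?exprn_gt0 ?mulr_gt0 ?ltr0n//.
by rewrite -natrX -natrM ler_nat; nia.
Qed.

(** A positive lower bound on ln r lets lower-order costs be absorbed. *)
Lemma ln_rank_ge (R : realType) (m : nat) : (0 < m)%N ->
  2^-1 <= ln (2 * m%:R) :> R.
Proof.
move=> m_gt0; apply: le_trans (ln2_ge R) _.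
by rewrite ler_ln ?posrE ?mulr_gt0 ?ltr0n// ler_peMr// ler1n.
Qed.

(** * The search over the guess *)

Section Search.
Context {R : realType} {d m : nat}.
Variables (v : 'I_m.+1 -> 'rV[R]_d) (gam : 'I_m.+1 -> R) (dir0 : 'rV[R]_d).
Variables (tie : nat -> nat -> 'rV[R]_d) (thr : R).
Hypothesis gam_ge0 : forall i, 0 <= gam i.
Hypothesis tie_le1 : forall i t, l2norm (tie i t) <= 1.
Hypotheses (m_gt0 : (0 < m)%N) (d_gt0 : (0 < d)%N).
Let D := diam v gam.
Let opt := ses_opt v gam.
Let lnr : R := ln (2 * m%:R).
Hypotheses (D_gt0 : 0 < D) (thr_gt0 : 0 < thr).

Definition guess (L U : R) : R := L + 1 / 3 * (U - L).
(** Its product with the guess is [(U - L) / 3], so either outcome keeps two thirds of the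
    interval. *)
Definition guess_tol (L U : R) : R := 1 / (3 * guess L U) * (U - L).

Definition search_next fuel i L U best : timed (option ('rV[R]_d * R)) :=
  if result (testT v gam dir0 D (guess L U) (guess_tol L U) (tie i)) is Some sph
  then searchT v gam dir0 D thr tie fuel i.+1 L
         ((1 + guess_tol L U) * guess L U) sph
  else searchT v gam dir0 D thr tie fuel i.+1 (guess L U) U best.

Lemma searchTS fuel i L U best : thr < U - L ->
  let s := searchT v gam dir0 D thr tie fuel.+1 i L U best in
  let s' := search_next fuel i L U best in
  result s = result s' /\
  (ops s <= 12 + ops (testT v gam dir0 D (guess L U) (guess_tol L U) (tie i)) +
            ops s')%N.
Proof.
rewrite ltNge => /negPf h; cbn zeta; rewrite /search_next.
cbn [searchT]; rewrite result_bind.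
have E : result (leT (subT (ret U) (ret L)) (ret thr)) = false by [].
rewrite E; cbv iota; rewrite 3!result_bind.
rewrite -[result (addT _ _)]/(guess L U).
rewrite -[result (mulT (divT (ret 1) (mulT (ret 3) (ret (guess L U)))) _)]/(guess_tol L U).
rewrite ops_bind E; cbv iota; rewrite 3!ops_bind.
rewrite -[result (addT _ _)]/(guess L U).
rewrite -[result (mulT (divT (ret 1) (mulT (ret 3) (ret (guess L U)))) _)]/(guess_tol L U).
rewrite -[ops (leT _ _)]/2%N -[ops (addT _ _)]/4%N -[ops (mulT _ _)]/4%N.
set T := testT _ _ _ _ _ _ _; case: (result T) => [sph|]; last by split; [|lia].
rewrite result_bind ops_bind -[result (mulT _ _)]/((1 + guess_tol L U) * guess L U).
by rewrite -[ops (mulT _ _)]/2%N; split; [|lia].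
Qed.

(** Numerator of the cost of a step with gap [x]: 324 = 36 * 9 stems from [eps * alpha = x / 3], and
    196 exceeds 12 + 2 * 62 + 24. *)
Let B : R := 196 * 324 * (m * d)%:R * D ^+ 2 * lnr.

Lemma ops_test_le alpha eps x i : 0 < x -> x <= D -> 0 < alpha -> 0 < eps ->
  eps * alpha = x / 3 ->
  12 + (ops (testT v gam dir0 D alpha eps (tie i)))%:R <= B / x ^+ 2.
Proof.
move=> x0 xD a0 e0 ea.
have md0 : (0 < m * d)%N by rewrite muln_gt0 m_gt0.
have L0 : 2^-1 <= lnr := ln_rank_ge R m_gt0.
set X : R := 324 * D ^+ 2 * lnr / x ^+ 2.
have T_le : (@rounds R m D alpha eps)%:R <= X + 1.
  have := @rounds_le R m D alpha eps m_gt0 D_gt0 a0 e0.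
  by rewrite ea (_ : _ / _ = X)//; rewrite /X /lnr; field; rewrite gt_eqF.
have X1 : 1 <= X.
  rewrite ler_pdivlMr ?exprn_gt0// mul1r.
  have x2 : x ^+ 2 <= D ^+ 2 by rewrite lerXn2r// nnegrE ltW.
  have D2 : 0 < D ^+ 2 by rewrite exprn_gt0.
  have : D ^+ 2 * 2^-1 <= D ^+ 2 * lnr by rewrite ler_pM2l.
  rewrite (mulrAC 324) -mulrA (mulrC lnr); move: x2 D2; set p := D ^+ 2 * lnr.
  set q := D ^+ 2; set y := x ^+ 2; lra.
have := ops_testT v gam dir0 m_gt0 d_gt0 D alpha eps (tie i).
rewrite -(ler_nat R) natrD !natrM => h.
have md1 : 1 <= m%:R * d%:R :> R by rewrite -natrM ler1n.
have -> : B / x ^+ 2 = 196 * (m%:R * d%:R) * X.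
  by rewrite /B /X natrM; field; rewrite gt_eqF.
move: h md1 T_le X1; set y := m%:R * d%:R.
set o := (ops _)%:R; set T := (rounds _ _ _)%:R.
move=> h md1 T_le X1.
have : y * T <= y * (X + 1) by rewrite ler_wpM2l//; lra.
have : y * 1 <= y * X by rewrite ler_wpM2l//; lra.
lra.
Qed.

(* The gap [U - L] shrinks by the factor 2/3, so the costs [B / (U - L) ^+ 2] of
   the tests grow geometrically and are dominated by the last one. *)
Lemma searchT_correct k i L U best :
  D / 2 <= L -> L <= opt -> U <= D -> thr / 2 <= U - L ->
  U - L <= thr * (3 / 2) ^+ k -> encloses v gam best.1 best.2 -> best.2 = U ->
  exists fuel (c : 'rV[R]_d) (rad : R),
    [/\ result (searchT v gam dir0 D thr tie fuel i L U best) = Some (c, rad),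
        encloses v gam c rad, rad <= opt + thr &
        (ops (searchT v gam dir0 D thr tie fuel i L U best))%:R <=
          2 + B * (4 / thr ^+ 2 - 1 / (U - L) ^+ 2)].
Proof.
have D0 := D_gt0; have t0 := thr_gt0.
have B0 : 0 <= B.
  have L0 : 0 <= lnr by apply: le_trans (ln_rank_ge R m_gt0); rewrite invr_ge0.
  have c0 : 0 <= 196 * 324 :> R by exact: mulr_ge0 (ler0n _ _) (ler0n _ _).
  exact: mulr_ge0 (mulr_ge0 (mulr_ge0 c0 (ler0n _ _)) (sqr_ge0 D)) L0.
have stop i' L' U' best' : thr / 2 <= U' - L' -> L' <= opt -> U' - L' <= thr ->
    encloses v gam best'.1 best'.2 -> best'.2 = U' ->
    exists fuel (c : 'rV[R]_d) (rad : R),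
    [/\ result (searchT v gam dir0 D thr tie fuel i' L' U' best') = Some (c, rad),
        encloses v gam c rad, rad <= opt + thr &
        (ops (searchT v gam dir0 D thr tie fuel i' L' U' best'))%:R <=
          2 + B * (4 / thr ^+ 2 - 1 / (U' - L') ^+ 2)].
  move=> gap' Lopt' st enc' rad'; exists 1, best'.1, best'.2.
  have x0 : 0 < U' - L' by lra.
  have E : result (leT (subT (ret U') (ret L')) (ret thr)) = true by [].
  cbn [searchT]; rewrite result_bind ops_bind E; split => //.
  - by congr Some; case: (best').
  - by rewrite rad'; lra.
  (* Only the stopping test is paid; the rest of the bound is nonnegative because the gap is at
     least [thr / 2]. *)
  rewrite -[(ops _ + _)%N]/2%N lerDl mulr_ge0// subr_ge0 div1r.
  rewrite -[4 / _]invf_div lef_pV2 ?posrE ?divr_gt0 ?exprn_gt0//.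
  rewrite (_ : _ / _ = (thr / 2) ^+ 2); last by field.
  by rewrite lerXn2r// nnegrE; lra.
elim: k i L U best => [|k IH] i L U best DL Lopt UD gap gapk enc rad.
  by apply: stop => //; rewrite expr0 mulr1 in gapk.
have [st|go] := leP (U - L) thr; first exact: stop.
have x0 : 0 < U - L by lra.
set x := U - L in x0 go gap gapk *.
have aE : guess L U = L + x / 3 by rewrite /guess -/x; field.
have a0 : 0 < guess L U by lra.
have e0 : 0 < guess_tol L U by rewrite /guess_tol mulr_gt0// divr_gt0// mulr_gt0.
have eaE : guess_tol L U * guess L U = x / 3.
  by rewrite /guess_tol -/x; field; rewrite gt_eqF.
have xD : x <= D by rewrite /x; lra.
(* The lower bound on the gap survives because a step is made only when [x] exceeds [thr]. *)
have gap' : thr / 2 <= 2 / 3 * x by lra.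
have gapk' : 2 / 3 * x <= thr * (3 / 2) ^+ k.
  move: gapk; rewrite exprS; set y := _ ^+ k => h.
  have : thr * (3 / 2 * y) = 3 / 2 * (thr * y) by ring.
  lra.
have eaD : guess_tol L U * guess L U <= D by lra.
have UE : U = L + x by rewrite /x addrC subrK.
have aD : guess L U <= D by lra.
have cost := ops_test_le i x0 xD a0 e0 eaE.
(* The telescoping step: the shrunk gap contributes [- 9 / 4 * (B / x ^+ 2)], which pays for the
   test and leaves [- B / x ^+ 2]. *)
have finish fuel (y : R) : y = 2 / 3 * x ->
    (ops (search_next fuel i L U best))%:R <= 2 + B * (4 / thr ^+ 2 - 1 / y ^+ 2) ->
    (ops (searchT v gam dir0 D thr tie fuel.+1 i L U best))%:R <=
    2 + B * (4 / thr ^+ 2 - 1 / x ^+ 2).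
  move=> -> h; have [_] := searchTS fuel i best go; rewrite -(ler_nat R) 2!natrD.
  move=> /le_trans; apply; move: cost h.
  have -> : B * (4 / thr ^+ 2 - 1 / (2 / 3 * x) ^+ 2) =
    B * (4 / thr ^+ 2) - 9 / 4 * (B / x ^+ 2) by field; rewrite !gt_eqF.
  have -> : B * (4 / thr ^+ 2 - 1 / x ^+ 2) = B * (4 / thr ^+ 2) - B / x ^+ 2.
    by field; rewrite !gt_eqF.
  have : 0 <= B / x ^+ 2 by rewrite divr_ge0// exprn_ge0// ltW.
  set z := B / x ^+ 2; set w := B * (4 / _); lra.
have := testT_correct dir0 m_gt0 D_gt0 a0 e0 eaD aD gam_ge0 (diam_ge v gam)
  (tie_le1 i).
case E: (result _) => [[u r]|] H.
- have [rE enc'] := H.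
  have yE : (1 + guess_tol L U) * guess L U - L = 2 / 3 * x.
    by rewrite mulrDl mul1r eaE aE; field.
  have [|||fuel [c [rad' [h1 h2 h3 h4]]]] :=
    IH i.+1 L ((1 + guess_tol L U) * guess L U) (u, r) DL Lopt _ _ _ enc' rE.
  - by have := yE; rewrite /x; lra.
  - by rewrite yE.
  - by rewrite yE.
  exists fuel.+1, c, rad'; split => //.
    by have [-> _] := searchTS fuel i best go; rewrite /search_next E.
  by apply: finish yE _; rewrite /search_next E.
- have yE : U - guess L U = 2 / 3 * x by rewrite aE /x; field.
  have [||||fuel [c [rad' [h1 h2 h3 h4]]]] :=
    IH i.+1 (guess L U) U best _ _ UD _ _ enc rad.
  - lra.
  - exact: ses_opt_ge m_gt0 H.
  - by rewrite yE.
  - by rewrite yE.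
  exists fuel.+1, c, rad'; split => //.
    by have [-> _] := searchTS fuel i best go; rewrite /search_next E.
  by apply: finish yE _; rewrite /search_next E.
Qed.

End Search.

(** * Termination of the search and the final bound *)

Lemma le_geometric_growth (R : realType) (x y : R) : 0 < y ->
  exists k, x <= y * (3 / 2) ^+ k.
Proof.
move=> y0; pose k := Num.bound (2 * `|x| / y); exists k.
(* Bernoulli's inequality. *)
have ge k' : k'%:R / 2 + 1 <= (3 / 2) ^+ k' :> R.
  elim: k' => [|k' IH]; first by rewrite mul0r add0r expr0.
  rewrite exprS -natr1; have : 0 <= k'%:R :> R by [].
  lra.
have := archi_boundP (_ : 0 <= 2 * `|x| / y); rewrite -/k => /(_ _) h.
have {h} : 2 * `|x| / y < k%:R by apply: h; rewrite divr_ge0 ?mulr_ge0// ltW.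
rewrite ltr_pdivrMr// => h.
have : k%:R / 2 * y <= (3 / 2) ^+ k * y.
  by rewrite ler_pM2r//; have := ge k; lra.
by have := ler_norm x; rewrite [y * _]mulrC; lra.
Qed.

Lemma metaTE (R : realType) (d m : nat) (v : 'I_m.+1 -> 'rV[R]_d)
    (gam : 'I_m.+1 -> R) dir0 eps opt tie fuel :
  let D := diam v gam in
  let thr := eps * odflt (D / 2) opt in
  let s := searchT v gam dir0 D thr tie fuel 1 (D / 2) D (v ord0, D) in
  result (metaT v gam dir0 eps opt tie fuel) = result s /\
  ops (metaT v gam dir0 eps opt tie fuel) = (ops (diamT v gam) + (1 + (1 + ops s)))%N.
Proof.
cbn zeta; rewrite /metaT result_bind ops_bind diamTE.
by rewrite result_bind ops_bind result_bind ops_bind.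
Qed.

Theorem theorem4 :
  exists K : nat,
  forall (R : realType) (d m : nat)
    (v : 'I_m.+1 -> 'rV[R]_d) (gam : 'I_m.+1 -> R) (eps : R)
    (dir0 : 'rV[R]_d) (tie : nat -> nat -> 'rV[R]_d) (opt : option R),
  (0 < d)%N -> (2 <= m.+1)%N ->
  (forall i, 0 <= gam i) ->
  0 < eps -> eps <= 1 ->
  l2norm dir0 = 1 ->
  (forall i t, l2norm (tie i t) <= 1) ->
  opt = Some (ses_opt v gam) \/ opt = None ->
  exists (fuel : nat) (c : 'rV[R]_d) (rad : R),
    [/\ result (metaT v gam dir0 eps opt tie fuel) = Some (c, rad),
        encloses v gam c rad,
        rad <= (1 + eps) * ses_opt v gam
      & (ops (metaT v gam dir0 eps opt tie fuel))%:R
          <= K%:R * (m.+1%:R * d%:R * ln m.+1%:R / eps ^+ 2)].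
Proof.
(* The constant is known only through its cast, so no unary numeral gets unfolded. *)
have [K KE] : exists K : nat, forall R : realType, K%:R = 10 ^+ 7 :> R.
  by exists (10 ^ 7)%N => R; rewrite natrX.
exists K => R d m v gam eps dir0 tie opt d_gt0; rewrite ltnS => m_gt0.
move=> gam_ge0 e0 e1 _ tie_le1 optE; rewrite KE.
pose D := diam v gam; pose thr := eps * odflt (D / 2) opt.
have D0 : 0 <= D by exact: diam_ge0.
have oD : D / 2 <= ses_opt v gam by exact: ses_opt_ge_diam.
have oD' : ses_opt v gam <= D by exact: ses_opt_le_diam.
(* Both choices of [opt] are covered: the upper bound gives accuracy, the lower one gives the
   running time. *)
have [thr1 thr2] : eps * (D / 2) <= thr /\ thr <= eps * ses_opt v gam.
  by rewrite /thr; case: optE => -> /=; split; rewrite ler_pM2l ?lexx.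
have thrD : thr <= D.
  by apply: (le_trans thr2); apply: le_trans oD'; rewrite ler_piMl//; lra.
have Dpos := ops_diamT v gam m_gt0 d_gt0.
set N : R := m%:R * d%:R.
have N0 : 0 <= N by rewrite mulr_ge0.
have opsD : (ops (diamT v gam))%:R <= 7 * N by rewrite /N -!natrM ler_nat.
have N1 : 1 <= N by rewrite /N -natrM ler1n muln_gt0 m_gt0.
have l0 := ln_rank_ge R m_gt0; have l1 := ln_rank_le R m_gt0.
set lnr := ln (2 * m%:R) in l0 l1.
have ie0 : 0 < (eps ^+ 2)^-1 by rewrite invr_gt0 exprn_gt0.
set M : R := m.+1%:R * d%:R * ln m.+1%:R / eps ^+ 2.
have bound : N * lnr / eps ^+ 2 <= 2 * M.
  rewrite /M mulrA ler_pM2r// mulrCA ler_pM//; first by lra.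
  by rewrite ler_wpM2r// ler_nat.
have base : N <= 2 * (N * lnr / eps ^+ 2).
  have h1 : 1 <= (eps ^+ 2)^-1 by rewrite invf_ge1 ?exprn_gt0// expr_le1// ltW.
  have h2 : N * 2^-1 <= N * lnr by rewrite ler_wpM2l.
  have h3 : N * lnr * 1 <= N * lnr * (eps ^+ 2)^-1.
    by rewrite ler_wpM2l// mulr_ge0//; lra.
  lra.
suff [fuel [c [rad [h1 h2 h3 h4]]]] : exists fuel (c : 'rV[R]_d) (rad : R),
    [/\ result (searchT v gam dir0 D thr tie fuel 1 (D / 2) D (v ord0, D)) = Some (c, rad),
        encloses v gam c rad, rad <= ses_opt v gam + thr &
        (ops (searchT v gam dir0 D thr tie fuel 1 (D / 2) D (v ord0, D)))%:R <=
          2 + 16 * 196 * 324 * (N * lnr / eps ^+ 2)].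
  exists fuel, c, rad; have [-> ->] := metaTE v gam dir0 eps opt tie fuel.
  split => //; first by lra.
  rewrite 3!natrD; lra.
(* If [D = 0], the initial gap is 0 and the first sphere is returned at once. *)
have [D00|D_neq0] := eqVneq D 0.
  exists 1, (v ord0), D.
  have E : result (leT (subT (ret D) (ret (D / 2))) (ret thr)) = true.
    by rewrite -[LHS]/(D - D / 2 <= thr) D00; rewrite D00 in thr1; lra.
  cbn [searchT]; rewrite result_bind ops_bind E; split => //.
  - exact: encloses_diam.
  - by rewrite D00 in oD thr1 *; lra.
  rewrite -[(ops _ + _)%N]/2%N; lra.
have D_gt0 : 0 < D by rewrite lt_neqAle eq_sym D_neq0.
have thr_gt0 : 0 < thr by apply: lt_le_trans thr1; rewrite mulr_gt0// divr_gt0.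
have [k Dk] := le_geometric_growth (D - D / 2) thr_gt0.
have [||//|fuel [c [rad [h1 h2 h3 h4]]]] := searchT_correct dir0 gam_ge0 tie_le1 m_gt0 d_gt0
  D_gt0 thr_gt0 1 (U := D) (best := (v ord0, D)) (lexx (D / 2)) oD (lexx D) _ Dk.
- lra.
- exact: encloses_diam.
exists fuel, c, rad; split => //; apply: (le_trans h4); rewrite lerD2l.
rewrite -/D -/lnr natrM -/N.
have eD0 : 0 < eps * D by rewrite mulr_gt0.
(* The [D ^+ 2] here cancels the one in the cost, leaving a bound independent of the scale of the
   input. *)
have thr_sq : 4 / thr ^+ 2 <= 16 / (eps * D) ^+ 2.
  rewrite -[16 / _]invf_div -[4 / _]invf_div lef_pV2 ?posrE ?divr_gt0 ?exprn_gt0//.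
  have -> : (eps * D) ^+ 2 / 16 = (eps * (D / 2)) ^+ 2 / 4 by field.
  rewrite ler_pM2r// lerXn2r// nnegrE ?(ltW thr_gt0)//.
  by rewrite mulr_ge0 ?divr_ge0// ltW.
have gap_sq : 0 <= 1 / (D - D / 2) ^+ 2 by rewrite divr_ge0// sqr_ge0.
set C := 196 * 324 * N * D ^+ 2 * lnr.
have lnr0 : 0 <= lnr by apply: le_trans l0; rewrite invr_ge0.
have C0 : 0 <= C.
  have c0 : 0 <= 196 * 324 :> R by exact: mulr_ge0 (ler0n _ _) (ler0n _ _).
  exact: mulr_ge0 (mulr_ge0 (mulr_ge0 c0 N0) (sqr_ge0 D)) lnr0.
have step : C * (4 / thr ^+ 2 - 1 / (D - D / 2) ^+ 2) <= C * (16 / (eps * D) ^+ 2).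
  by apply: ler_wpM2l => //; rewrite lerBlDr (le_trans thr_sq)// lerDl.
apply: le_trans step _; rewrite /C.
by rewrite le_eqVlt; apply/orP; left; apply/eqP; field; rewrite !gt_eqF.
Qed.
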